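(* Let $\Delta$ be an irreducible finite reduced root system that is not of type $A_1$. Then for every $w\in\mathrm{Aut}(\Delta)$, $$(wF)(\mathbf{t},\mathbf{y};\Delta)=F(\mathbf{t},\mathbf{y};\Delta)$$ for $\mathbf{t}\in\mathbb{C}^{\lvert\Delta_+\rvert}$ (as meromorphic functions of $\mathbf{t}$) and $\mathbf{y}\in V$. Hence for $\mathbf{k}\in\mathbb{Z}_{\ge0}^{\lvert\Delta_+\rvert}$ and $\mathbf{y}\in V$, $$(wP)(\mathbf{k},\mathbf{y};\Delta)=\Bigl(\prod_{\alpha\in\Delta_{w^{-1}}}(-1)^{-k_\alpha}\Bigr)P(\mathbf{k},\mathbf{y};\Delta).$$
   Context: $V$ is an $r$-dimensional real inner product space, $V^*$ identified with $V$; $\Delta\subset V$ is a root system with fundamental system $\Psi=\{\alpha_1,\dots,\alpha_r\}$, positive/negative roots $\Delta_\pm$, coroots $\alpha^\vee$; fundamental weights satisfy $\langle\alpha_i^\vee,\lambda_j\rangle=\delta_{ij}$. $\mathrm{Aut}(\Delta)\subset\mathrm{GL}(V)$ is the group of linear automorphisms stabilizing $\Delta$. For $w\in\mathrm{Aut}(\Delta)$, $\Delta_w=\Delta_+\cap w^{-1}\Delta_-$. $\{x\}=x-[x]$; $B_k(x)$ is the $k$-th Bernoulli polynomial. Vectors $\mathbf{k}=(k_\alpha)$, $\mathbf{t}=(t_\alpha)$ are indexed by $\Delta/\{\pm1\}$ (so $k_{-\alpha}=k_\alpha$, $t_{-\alpha}=t_\alpha$). Define $$P(\mathbf{k},\mathbf{y};\Delta)=\int_0^1\!\!\cdots\!\int_0^1\Bigl(\prod_{\alpha\in\Delta_+\setminus\Psi}B_{k_\alpha}(x_\alpha)\Bigr)\biggl(\prod_{i=1}^rB_{k_{\alpha_i}}\Bigl(\Bigl\{\langle\mathbf{y},\lambda_i\rangle-\sum_{\alpha\in\Delta_+\setminus\Psi}x_\alpha\langle\alpha^\vee,\lambda_i\rangle\Bigr\}\Bigr)\biggr)\prod_{\alpha\in\Delta_+\setminus\Psi}dx_\alpha,$$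 $$F(\mathbf{t},\mathbf{y};\Delta)=\sum_{\mathbf{k}\in\mathbb{Z}_{\ge0}^{|\Delta_+|}}P(\mathbf{k},\mathbf{y};\Delta)\prod_{\alpha\in\Delta_+}\frac{t_\alpha^{k_\alpha}}{k_\alpha!}\quad(|t_\alpha|<2\pi),$$ and for fixed $\mathbf{y}$ continue $F$ meromorphically in $\mathbf{t}$ to $\mathbb{C}^{|\Delta_+|}$. Actions of $\mathrm{Aut}(\Delta)$: on $\mathbf{k}$ by $(w\mathbf{k})_\alpha=k_{w^{-1}\alpha}$; on $\mathbf{t}$ by, for $\alpha\in\Delta_+$, $(w\mathbf{t})_\alpha=t_{w^{-1}\alpha}$ if $\alpha\in\Delta_+\setminus\Delta_{w^{-1}}$ and $(w\mathbf{t})_\alpha=-t_{w^{-1}\alpha}$ if $\alpha\in\Delta_{w^{-1}}$; on functions by $(wF)(\mathbf{t},\mathbf{y})=F(w^{-1}\mathbf{t},w^{-1}\mathbf{y})$ and $(wP)(\mathbf{k},\mathbf{y})=P(w^{-1}\mathbf{k},w^{-1}\mathbf{y})$. *)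

(* Defs.v *)
From HB Require Import structures.
From mathcomp Require Import all_boot all_order all_algebra finmap complex.
From mathcomp Require Import all_classical all_reals all_analysis.
From mathcomp Require Import summability.

Set Implicit Arguments.
Unset Strict Implicit.
Unset Printing Implicit Defensive.

Import Order.TTheory GRing.Theory Num.Theory.
Import numFieldNormedType.Exports.

Local Open Scope classical_set_scope.
Local Open Scope fset_scope.
Local Open Scope complex_scope.
Local Open Scope ring_scope.

Section RootSystems.
Variables (R : realType) (V : vectType R) (dot : {dot V for idfun}).

Definition coroot (a : V) : V := (2 / dot a a) *: a.

Definition reflection (a v : V) : V := v - dot (coroot a) v *: a.

Record root_system (D : {fset V}) : Prop := RootSystem {
  root_neq0 : 0 \notin D;
  root_span : <<enum_fset D>>%VS = fullv;
  root_reflection : {in D &, forall a b, reflection a b \in D};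
  root_integral : {in D &, forall a b, dot (coroot a) b \is a Num.int} }.

Definition reduced (D : {fset V}) : Prop :=
  forall (a : V) (c : R), a \in D -> c *: a \in D -> c = 1 \/ c = -1.

Definition irreducible (D : {fset V}) : Prop :=
  D != fset0 /\
  ~ exists D1 D2 : {fset V},
      [/\ D1 != fset0, D2 != fset0, D = D1 `|` D2
        & forall a b, a \in D1 -> b \in D2 -> dot a b = 0].

Definition type_A1 (D : {fset V}) : Prop :=
  exists a : V, a != 0 /\ D = [fset a; - a].

Record fundamental_system (D : {fset V}) (r : nat) (Psi : r.-tuple V) : Prop :=
  FundamentalSystem {
    fundamental_basis : basis_of fullv Psi;
    fundamental_root : {subset Psi <= D};
    fundamental_sign : forall a, a \in D ->
      (forall i, coord Psi i a \is a Num.nat) \/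
      (forall i, - coord Psi i a \is a Num.nat) }.

Definition fundamental_weights (r : nat) (Psi : r.-tuple V)
    (lam : 'I_r -> V) : Prop :=
  forall i j, dot (coroot (tnth Psi i)) (lam j) = (i == j)%:R.

Definition Aut (D : {fset V}) (w : 'End(V)) : Prop :=
  lker w = 0%VS /\ [fset w a | a in D] = D.

Definition pos_roots (D : {fset V}) (r : nat) (Psi : r.-tuple V) : {fset V} :=
  [fset a in D | [forall i : 'I_r, 0 <= coord Psi i a]].

Definition neg_roots (D : {fset V}) (r : nat) (Psi : r.-tuple V) : {fset V} :=
  [fset - a | a in pos_roots D Psi].

Definition inversion_set (D : {fset V}) (r : nat) (Psi : r.-tuple V)
    (w : 'End(V)) : {fset V} :=
  pos_roots D Psi `&` [fset (w^-1)%VF a | a in neg_roots D Psi].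

End RootSystems.

(* Families indexed by the quotient of D by {1, -1} are represented by their
   values on the positive roots. [at_root f a] is the value of such a family at
   the class of an arbitrary root a; its value 0 off the root system is junk. *)
Definition root_vector (R : realType) (V : vectType R) (D : {fset V}) (r : nat)
    (Psi : r.-tuple V) (A : Type) : Type :=
  {ffun pos_roots D Psi -> A}.

Definition at_root (R : realType) (V : vectType R) (D : {fset V}) (r : nat)
    (Psi : r.-tuple V) (A : nmodType) (f : root_vector D Psi A) (a : V) : A :=
  if insub a is Some b then f b else
  if insub (- a) is Some b then f b else 0.

(* [:: B_0; ..; B_(n-1)], from the coefficient of t^(n+1) in
   (e^t - 1) * \sum_k B_k(x) t^k / k! = t e^(x t), that is,
   \sum_(j <= n) 'C(n+1, j) B_j(x) = (n+1) x^n. *)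
Fixpoint bernoulli_seq (R : realType) (n : nat) : seq {poly R} :=
  if n is m.+1 then
    let s := bernoulli_seq R m in
    rcons s ('X^m -
      m.+1%:R^-1 *: \sum_(j < m) s`_j *+ 'C(m.+1, j))
  else [::].

Definition bernoulli (R : realType) (n : nat) : {poly R} :=
  (bernoulli_seq R n.+1)`_n.

Definition frac_part (R : realType) (x : R) : R := x - (Num.floor x)%:~R.

(* The iterated integral over x_i in [0, 1] for i in s; the coordinates of x
   outside s are set to 0. *)
Fixpoint unit_cube_integral (R : realType) (I : eqType) (s : seq I)
    (G : (I -> R) -> R) : R :=
  if s is i :: s' then
    \int[lebesgue_measure]_(u in `[0%R, 1%R])
      unit_cube_integral s' (fun x => G [eta x with i |-> u])
  else G (fun=> 0).

Section HolomorphicFunctions.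
Variables (R : realType) (I : finType).
Local Notation C := R[i].

Definition in_polydisc (p : {ffun I -> C}) (e : R) (z : {ffun I -> C}) : Prop :=
  forall i, `|z i - p i| < e%:C.

(* Unconditional convergence of the family a indexed by multi-indices. *)
Definition multi_sum_to (a : {ffun I -> nat} -> C) (l : C) : Prop :=
  (partial_sum a : {fset {ffun I -> nat}} -> C^o) @ totally --> (l : C^o).

Definition holomorphic_at (f : {ffun I -> C} -> C) (p : {ffun I -> C}) : Prop :=
  exists (e : R) (c : {ffun I -> nat} -> C), 0 < e /\
    forall z, in_polydisc p e z ->
      multi_sum_to (fun k => c k * \prod_i (z i - p i) ^+ k i) (f z).

(* The values of f at the zeros of the local denominators are irrelevant. *)
Definition meromorphic (f : {ffun I -> C} -> C) : Prop :=
  forall p, exists (e : R) (g h : {ffun I -> C} -> C),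
    [/\ 0 < e,
        forall z, in_polydisc p e z -> holomorphic_at g z /\ holomorphic_at h z,
        exists2 z, in_polydisc p e z & h z != 0
      & forall z, in_polydisc p e z -> h z != 0 -> f z = g z / h z].

Definition meromorphic_eq (f g : {ffun I -> C} -> C) : Prop :=
  [/\ meromorphic f, meromorphic g
    & forall p, holomorphic_at f p -> holomorphic_at g p -> f p = g p].

End HolomorphicFunctions.

Section BernoulliFunctions.
Variables (R : realType) (V : vectType R) (dot : {dot V for idfun}).
Variables (D : {fset V}) (r : nat) (Psi : r.-tuple V) (lam : 'I_r -> V).
Local Notation C := R[i].

Definition nonsimple_pos_roots : {fset V} :=
  [fset a in pos_roots D Psi | a \notin (Psi : seq V)].

Definition P (k : root_vector D Psi nat) (y : V) : R :=
  unit_cube_integral (enum_fset nonsimple_pos_roots) (fun x : V -> R =>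
    (\prod_(a <- nonsimple_pos_roots) (bernoulli R (at_root k a)).[x a]) *
    \prod_(i < r) (bernoulli R (at_root k (tnth Psi i))).[frac_part
      (dot y (lam i)
       - \sum_(a <- nonsimple_pos_roots) x a * dot (coroot dot a) (lam i))]).

Definition F_term (t : root_vector D Psi C) (y : V)
    (k : root_vector D Psi nat) : C :=
  (P k y)%:C * \prod_a (t a ^+ k a / (k a)`!%:R).

Definition is_F (F : root_vector D Psi C -> V -> C) : Prop :=
  forall y, meromorphic (F^~ y) /\
    forall t : root_vector D Psi C, (forall a, `|t a| < (2 * pi)%:C) ->
      multi_sum_to (F_term t y) (F t y).

End BernoulliFunctions.

Section Actions.
Variables (R : realType) (V : vectType R).
Variables (D : {fset V}) (r : nat) (Psi : r.-tuple V) (w : 'End(V)).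
Local Notation C := R[i].

Definition act_k (k : root_vector D Psi nat) : root_vector D Psi nat :=
  [ffun a => at_root k ((w^-1)%VF (val a))].

Definition act_t (t : root_vector D Psi C) : root_vector D Psi C :=
  [ffun a => if val a \in inversion_set D Psi (w^-1)%VF
             then - at_root t ((w^-1)%VF (val a))
             else at_root t ((w^-1)%VF (val a))].

End Actions.

Definition act_F (R : realType) (V : vectType R) (D : {fset V}) (r : nat)
    (Psi : r.-tuple V) (w : 'End(V)) (F : root_vector D Psi R[i] -> V -> R[i]) :
    root_vector D Psi R[i] -> V -> R[i] :=
  fun t y => F (act_t (w^-1)%VF t) ((w^-1)%VF y).

Definition act_P (R : realType) (V : vectType R) (D : {fset V}) (r : nat)
    (Psi : r.-tuple V) (w : 'End(V)) (Q : root_vector D Psi nat -> V -> R) :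
    root_vector D Psi nat -> V -> R :=
  fun k y => Q (act_k (w^-1)%VF k) ((w^-1)%VF y).

(* Main.v *)
Require Import Defs.
From HB Require Import structures.
From mathcomp Require Import all_boot all_order all_algebra finmap complex.
From mathcomp Require Import all_classical all_reals all_analysis.
From mathcomp Require Import summability measurable_realfun.
From mathcomp Require Import zify ring lra.

(** Write x_alpha for coordinates indexed by the positive roots.  P(k, y) is the
integral of prod_alpha B_{k_alpha}({x_alpha}) over the points x of the torus
(R/Z)^{Delta_+} with sum_alpha x_alpha alpha^vee = y, a coset of a subtorus; the
definition of P parametrizes this coset by the non-simple coordinates.  An
automorphism w acts on these cosets by signed permutations of the coordinates,
so the symmetry of P follows from B_n(1 - x) = (-1)^n B_n(x) once the integral
is known not to depend on the parametrization.  The latter is the uniqueness of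
Haar measure: averaging over two parametrizations at once and using translation
invariance in either one gives both integrals.  The reflection formula fails
for B_1({x}) at integers only; as Delta is irreducible and not of type A_1, no
coordinate is constant on the cosets, so this set is negligible.

Comparing Taylor coefficients, wF = F near t = 0, and the two sides agree
wherever both are holomorphic by the identity theorem, obtained by restriction
to real segments from the one-variable case. *)

Set Implicit Arguments.
Unset Strict Implicit.
Unset Printing Implicit Defensive.

Import Order.TTheory GRing.Theory Num.Theory.
Import numFieldNormedType.Exports.

Local Open Scope classical_set_scope.
Local Open Scope fset_scope.
Local Open Scope complex_scope.
Local Open Scope ring_scope.

(** * Bernoulli polynomials *)

(** The numbers <a^vee, lam_i> are integers, so the projection of R^{Delta_+} onto the kernel of x
    |-> sum x_a a^vee along the simple coordinates has an integer matrix, and the integrand is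
    periodic in every parameter. All positive coordinates are kept as parameters, the simple ones
    being dummies: transporting the projection by w then gives another square integer matrix on the
    same coordinates, although w mixes simple and non-simple roots. Transport requires w (a^vee) =
    (w a)^vee. An automorphism preserves the integers <a^vee, b>, and irreducibility then forces it
    to be an isometry. The integers matter twice: in the reflection formula, and because the
    non-simple factors of P are B_k(x_a) without fractional part, which for k = 1 differ from the
    periodic function at x_a = 1. A coordinate constant on the cosets would be some x_{alpha_i} such
    that alpha_i^vee occurs in no other positive coroot, which would split off {alpha_i, -alpha_i}
    as a component. For F, values at poles are arbitrary, so what is propagated along a segment is
    equality off the zeros of a nonzero analytic function. *)

Section Bernoulli.
Variable R : realType.

Lemma size_bernoulli_seq n : size (bernoulli_seq R n) = n.
Proof. by elim: n => //= n IH; rewrite size_rcons IH. Qed.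

Lemma nth_bernoulli_seq n m : (m < n)%N -> (bernoulli_seq R n)`_m = bernoulli R m.
Proof.
elim: n => // n IH; rewrite ltnS leq_eqVlt => /orP[/eqP->//|mn].
rewrite /= nth_rcons size_bernoulli_seq mn; exact: IH.
Qed.

Lemma bernoulliE n :
  bernoulli R n = 'X^n - n.+1%:R^-1 *: \sum_(j < n) bernoulli R j *+ 'C(n.+1, j).
Proof.
rewrite {1}/bernoulli /= nth_rcons size_bernoulli_seq ltnn eqxx.
by congr (_ - _ *: _); apply: eq_bigr => j _; rewrite nth_bernoulli_seq.
Qed.

Lemma bernoulli_sum n :
  \sum_(j < n.+1) bernoulli R j *+ 'C(n.+1, j) = n.+1%:R *: 'X^n.
Proof.
rewrite big_ord_recr/= [in X in _ + X]bernoulliE binSn -scaler_nat scalerBr scalerA.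
by rewrite divff ?pnatr_eq0// scale1r addrC subrK.
Qed.

(** The system is triangular with diagonal coefficients n + 1, so it has at most one solution.
    Identities between Bernoulli polynomials follow once both sides satisfy the same recurrence. *)
Lemma binomial_sum_inj (W : lmodType R) (f g : nat -> W) :
  (forall n, \sum_(j < n.+1) f j *+ 'C(n.+1, j) =
             \sum_(j < n.+1) g j *+ 'C(n.+1, j)) -> f =1 g.
Proof.
move=> fg; elim/ltn_ind => n IH; have := fg n; rewrite !big_ord_recr/=.
rewrite (eq_bigr (fun j : 'I_n => g j *+ 'C(n.+1, j))); last first.
  by move=> j _; rewrite IH.
move=> /addrI; rewrite binSn => /eqP.
rewrite -subr_eq0 -mulrnBl -scaler_nat scaler_eq0 pnatr_eq0/= subr_eq0.
by move=> /eqP.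
Qed.

Lemma deriv_bernoulli n : (bernoulli R n.+1)^`() = n.+1%:R *: bernoulli R n.
Proof.
suff -> : bernoulli R n = n.+1%:R^-1 *: (bernoulli R n.+1)^`().
  by rewrite scalerA divff ?pnatr_eq0// scale1r.
symmetry; move: n; apply: binomial_sum_inj => n; rewrite bernoulli_sum.
(* Differentiation kills the constant B_0 and, as (j+1) C(n+2, j+1) = (n+2) C(n+1, j), leaves the
   recurrence for B'_{j+1} / (j+1). *)
have := congr1 (@deriv R) (bernoulli_sum n.+1).
rewrite derivZ derivXn raddf_sum/= big_ord_recl/= bernoulliE big_ord0 scaler0 subr0.
rewrite expr0 derivMn derivC mul0rn add0r => E.

have n2 : n.+2%:R != 0 :> R by rewrite pnatr_eq0.
apply: (scalerI n2); rewrite [in RHS]scaler_nat -E scaler_sumr.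
apply: eq_bigr => j _; rewrite /bump/= add1n derivMn.
rewrite -[RHS]scaler_nat -[X in _ *: X = _]scaler_nat !scalerA.
have j1 : j.+1%:R != 0 :> R by rewrite pnatr_eq0.
congr (_ *: _); apply: (mulIf j1); rewrite mulfVK// -!natrM.
by rewrite mul_bin_diag mulnC.
Qed.

Lemma size_bernoulli n : (size (bernoulli R n) <= n.+1)%N.
Proof.
elim/ltn_ind: n => n IH; rewrite bernoulliE.
apply: (leq_trans (size_polyD _ _)); rewrite geq_max size_polyXn leqnn size_polyN.
apply: (leq_trans (size_scale_leq _ _)); apply: (leq_trans (size_sum _ _ _)).
apply/bigmax_leqP => j _; rewrite -scaler_nat; apply: (leq_trans (size_scale_leq _ _)).
by apply: (leq_trans (IH _ (ltn_ord j))); rewrite ltnS ltnW.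
Qed.

Lemma nderivn_bernoulli n j : (bernoulli R n)^`N(j) = bernoulli R (n - j) *+ 'C(n, j).
Proof.
have [nj|jn] := ltnP n j.
  by rewrite bin_small// mulr0n nderivn_poly0//; apply: (leq_trans (size_bernoulli n)).
have dE k m : (bernoulli R (m + k))^`(k) = bernoulli R m *+ (m + k) ^_ k.
  elim: k m => [|k IH] m; first by rewrite addn0.
  rewrite derivnS -addSnnS IH derivMn deriv_bernoulli scaler_nat -mulrnA;
    congr (_ *+ _).
  by rewrite [in RHS]ffactnSr addnK mulnC.
have := nderivn_def j (bernoulli R n); rewrite -{1}(subnK jn) dE subnK//.
rewrite -bin_ffact mulrnA => /eqP.
rewrite -subr_eq0 -mulrnBl -scaler_nat scaler_eq0 pnatr_eq0 eqn0Ngt fact_gt0/=.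
by rewrite subr_eq0 => /eqP.
Qed.

Lemma bernoulli_horner_add n (x y : R) :
  (bernoulli R n).[x + y] =
  \sum_(j < n.+1) (bernoulli R (n - j)).[x] * y ^+ j *+ 'C(n, j).
Proof.
rewrite (nderiv_taylor_wide (mulrC x y) (size_bernoulli n)).
apply: eq_bigr => j _; rewrite nderivn_bernoulli hornerMn.
by rewrite mulrnAl.
Qed.

Lemma bernoulli_horner_sum n (x : R) :
  \sum_(j < n.+1) (bernoulli R j).[x] *+ 'C(n.+1, j) = n.+1%:R * x ^+ n.
Proof.
have := congr1 (fun p => p.[x]) (bernoulli_sum n).
rewrite horner_sum hornerZ hornerXn => <-.
by apply: eq_bigr => j _; rewrite hornerMn.
Qed.

(** Taylor expansion with increment 1: in reversed order, its terms other than B_{n+1}(x) form the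
    defining recurrence. *)
Lemma bernoulli_difference n (x : R) :
  (bernoulli R n.+1).[x + 1] - (bernoulli R n.+1).[x] = n.+1%:R * x ^+ n.
Proof.
rewrite bernoulli_horner_add big_ord_recl subn0 bin0 mulr1n expr0 mulr1 addrAC
  subrr add0r.
rewrite -bernoulli_horner_sum [RHS](reindex_inj rev_ord_inj)/=.
by apply: eq_bigr => j _; rewrite /bump/= add1n expr1n mulr1 -bin_sub ?subSS.
Qed.

Lemma signrB m n : (m <= n)%N -> (-1) ^+ (n - m) = (-1) ^+ n * (-1) ^+ m :> R.
Proof.
by move=> mn; rewrite -{2}(subnK mn) exprD -mulrA -expr2 sqrr_sign mulr1.
Qed.

(** The sequence (-1)^m B_m(1 - y) satisfies the recurrence of B_m(y): expand B_{n+1}(-y) around 1 -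
    y and use the difference formula at -y. *)
Lemma bernoulli_reflection n (x : R) :
  (bernoulli R n).[1 - x] = (-1) ^+ n * (bernoulli R n).[x].
Proof.

suff reflE m y : (bernoulli R m).[y] = (-1) ^+ m * (bernoulli R m).[1 - y].
  by rewrite (reflE n (1 - x)) opprB addrC subrK.
move: m; apply: (@binomial_sum_inj R^o) => {}n.
rewrite bernoulli_horner_sum.
have := bernoulli_horner_add n.+1 (1 - y) (-1).
rewrite addrAC subrr add0r (reindex_inj rev_ord_inj)/=.
under eq_bigr => j _.
  have jn : (j <= n.+1)%N by rewrite -ltnS.
  rewrite subSS subKn// bin_sub//.
  rewrite signrB//.
  rewrite mulrCA -mulrnAr [_.[_] * _]mulrC.
  over.
rewrite -mulr_sumr big_ord_recr/= binn mulr1n => E.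
have := bernoulli_difference n (- y); rewrite [- y + 1]addrC E.
rewrite mulrDr mulrA -expr2 sqrr_sign mul1r opprD addrCA subrr addr0.
rewrite (exprNn y) exprS -mulrA mulN1r opprK [RHS]mulrCA => /mulrI -> //.

by rewrite unitfE signr_eq0.
Qed.
End Bernoulli.

(** * Iterated integrals over the unit cube *)

Section PartialIntegrals.
Variable R : realType.
Local Notation mu := (@lebesgue_measure R).
Local Notation I01 := (`[0%R, 1%R]%classic : set R).

Let mI01 : measurable (I01 : set (measurableTypeR R)).
Proof. exact: measurable_itv. Qed.

Let I01_lty : (mu I01 < +oo)%E.
Proof. by rewrite lebesgue_measure_itv/= lte01 sube0 ltry. Qed.

(** Integrals over [0, 1] become integrals over the whole line for this finite measure, so that
    bounded measurable functions are integrable and the theorems on product measures apply. *)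
Let mu01 := mfrestr mI01 I01_lty.

Let integrable_bounded d (T : measurableType d)
    (m : {finite_measure set T -> \bar R}) (f : T -> R) (M : R) :
  measurable_fun setT f -> (forall x, `|f x| <= M) -> m.-integrable setT (EFin \o f).
Proof.
move=> mf fM; apply: measurable_bounded_integrable => //.
  by rewrite -ge0_fin_numE//; exact: fin_num_measure.
by exists M; split; [exact: num_real|move=> N MN x _;
  exact: (le_trans (fM x) (ltW MN))].
Qed.

Let integral_mu01 (f : R -> R) (M : R) : measurable_fun setT f ->
  (forall x, `|f x| <= M) ->
  (\int[mu]_(x in I01) (f x)%:E = \int[mu01]_x (f x)%:E)%E.
Proof.
move=> mf fM.
have := @negligible_integral _ _ R mu01 setT (~` I01) (EFin \o f).
rewrite setTD setCK => -> //; first last.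
- by rewrite /= /mfrestr /mrestr setICl measure0.
- exact: (integrable_bounded mu01 mf fM).
- exact: measurableC.
 apply: eq_measure_integral => A mA AI.
by rewrite /= /mfrestr /mrestr setIidl.
Qed.
 
Let integral01_fin (f : R -> R) (M : R) : measurable_fun setT f ->
  (forall x, `|f x| <= M) ->
  (\int[mu]_(x in I01) (f x)%:E \is a fin_num)%E.
Proof.
move=> mf fM; rewrite (integral_mu01 mf fM); apply: integrable_fin_num => //.
exact: (integrable_bounded mu01 mf fM).
Qed.

Lemma normr_Rintegral01_le (f : R -> R) (M : R) : measurable_fun setT f ->
  (forall x, `|f x| <= M) -> `|\int[mu]_(x in I01) f x| <= M.
Proof.
move=> mf fM; rewrite /Rintegral (integral_mu01 mf fM).
have M0 : 0 <= M by apply: le_trans (fM 0).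
have mT : (mu01 setT = 1)%E.
  transitivity (mu I01); first by congr (mu _); rewrite setTI.
  by rewrite lebesgue_measure_itv/= lte01 sube0.
have := @le_normr_Rintegral _ _ _ mu01 setT f measurableT (integrable_bounded mu01
  mf fM).
move=> /le_trans; apply.
rewrite -[leRHS]mulr1 -[X in _ * X]/(fine 1%E) -mT -Rintegral_cst//.
apply: le_Rintegral => //.
- by apply: (integrable_bounded mu01 (M := M)) => [|x];
  [exact: measurableT_comp|rewrite normr_id].
- by apply: (integrable_bounded mu01 (M := `|M|)).
Qed.

Lemma Rintegral01_cst (c : R) : \int[mu]_(x in I01) c = c.
Proof. by rewrite Rintegral_cst//= lebesgue_measure_itv/= lte01 sube0 mulr1. Qed.

Lemma measurable_Rintegral01 d (T : measurableType d) (f : T * R -> R) (M : R) :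
  measurable_fun setT f -> (forall x, `|f x| <= M) ->
  measurable_fun setT (fun t => \int[mu]_(u in I01) f (t, u)).
Proof.
move=> mf fM; rewrite /Rintegral;
  have m2 t : measurable_fun setT (fun u => f (t, u)) by exact: measurable_fun_pair2.
have mF : measurable_fun [set: T] (fubini_F mu01 (EFin \o f)^\+%E).
  apply: (@measurable_fun_fubini_tonelli_F _ _ _ _ R mu01) => //.
  by apply: measurable_funepos; exact/measurable_EFinP.
have mG : measurable_fun [set: T] (fubini_F mu01 (EFin \o f)^\-%E).
  apply: (@measurable_fun_fubini_tonelli_F _ _ _ _ R mu01) => //.
  by apply: measurable_funeneg; exact/measurable_EFinP.
apply: (@measurableT_comp _ _ _ _ _ _ (@fine R)) => //.
have := emeasurable_funB mF mG; congr measurable_fun.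
apply/funext => t; rewrite (@integral_mu01 (fun u => f (t, u)) M)// integralE.
by congr (_ - _)%E; apply: eq_integral => u _; rewrite ?(funeposE, funenegE).
Qed.

Lemma Rintegral01_swap (f : R * R -> R) (M : R) : measurable_fun setT f ->
  (forall x, `|f x| <= M) ->
  \int[mu]_(u in I01) \int[mu]_(v in I01) f (u, v) =
  \int[mu]_(v in I01) \int[mu]_(u in I01) f (u, v).
Proof.
move=> mf fM.
have m1 u : measurable_fun setT (fun v => f (u, v)) by exact: measurable_fun_pair2.
have m2 v : measurable_fun setT (fun u => f (u, v)) by exact: measurable_fun_pair1.
have b1 u x : `|f (u, x)| <= M by [].
have b2 u x : `|f (x, u)| <= M by [].
have mfs : measurable_fun setT (fun p : R * R => f (p.2, p.1)).
  by apply: measurableT_comp => //; apply: measurable_fun_pair.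
have E1 u : (\int[mu]_(v in I01) f (u, v))%:E = (\int[mu01]_v (f (u, v))%:E)%E.
  by rewrite /Rintegral fineK ?(integral01_fin (m1 u) (b1 u))// (integral_mu01 (m1
    u) (b1 u)).
have E2 u : (\int[mu]_(v in I01) f (v, u))%:E = (\int[mu01]_v (f (v, u))%:E)%E.
  by rewrite /Rintegral fineK ?(integral01_fin (m2 u) (b2 u))// (integral_mu01 (m2
    u) (b2 u)).
rewrite [LHS]/Rintegral [RHS]/Rintegral; congr fine.
rewrite (integral_mu01 (M := M) (measurable_Rintegral01 mf fM)); last first.
  by move=> x; exact: normr_Rintegral01_le.
rewrite (integral_mu01 (M := M) (measurable_Rintegral01 mfs (fun x =>
  fM (x.2, x.1)))); last first.
  by move=> x; exact: (normr_Rintegral01_le (m2 x) (b2 x)).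
under eq_integral => u _ do rewrite E1.
under [RHS]eq_integral => u _ do rewrite E2.
apply: (@Fubini _ _ _ _ R mu01 mu01 (EFin \o f)).
apply: measurable_bounded_integrable => //.
  apply: (@le_lt_trans _ _ (mu01 setT * mu01 setT)%E).
    by rewrite -product_measure1E// setXTT.
  rewrite lte_mul_pinfty//.
    exact: fin_num_measure.
  by rewrite -ge0_fin_numE//; exact: fin_num_measure.
by exists M; split; [exact: num_real|move=> N MN x _;
  exact: (le_trans (fM x) (ltW MN))].
Qed.

(** By uniqueness of Lebesgue measure, half-open intervals suffice. *)
Lemma lebesgue_measure_shift (c : R) (A : set R) : measurable A ->
  pushforward mu (fun x => x + c : measurableTypeR R) A = mu A.
Proof.
have mD : measurable_fun [set: measurableTypeR R] (fun x => x + c : measurableTypeR R).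
  exact: (@measurable_funD _ _ R setT id (cst c)).
move=> mA; apply/esym/lebesgue_measure_unique => //= _ [[a b]] _ <-.
rewrite /pushforward/=.
have -> : (fun x : R => x + c) @^-1` `]a, b] = `]a - c, b - c]%classic.
  by apply/seteqP; split => x /=; rewrite !in_itv/= ltrBlDr lerBrDr.
by rewrite !lebesgue_measure_itv/= !lte_fin ltrD2r -!EFinB opprB addrA subrK.
Qed.

Let integrable_itv (f : R -> R) (M : R) (i : interval R) : measurable_fun setT f ->
  (forall x, `|f x| <= M) -> (mu [set` i] < +oo)%E ->
  mu.-integrable [set` i] (EFin \o f).
Proof.
move=> mf fM ioo; apply: measurable_bounded_integrable => //.
  exact: measurable_funTS.
by exists M; split; [exact: num_real|move=> N MN x _;
  exact: (le_trans (fM x) (ltW MN))].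
Qed.

Let mu_itv_oc (a b : R) : (mu `]a, b] < +oo)%E.
Proof. by rewrite lebesgue_measure_itv/=; case: ifP => // _; rewrite -EFinD ltry. Qed.

Lemma Rintegral_shift (f : R -> R) (M a b c : R) : measurable_fun setT f ->
  (forall x, `|f x| <= M) ->
  \int[mu]_(x in `]a, b]) f (x + c) = \int[mu]_(x in `](a + c), (b + c)]) f x.
Proof.
move=> mf fM; rewrite /Rintegral; congr fine.
have mphi : measurable_fun [set: measurableTypeR R] (fun x =>
  x + c : measurableTypeR R).
  exact: (@measurable_funD _ _ R setT id (cst c)).
have abE : [set` `]a, b]] = (fun x : R => x + c) @^-1` `](a + c), (b + c)].
  by apply/seteqP; split => x /=; rewrite !in_itv/= ltrD2r lerD2r.
rewrite abE.
have := @integral_pushforward _ _ _ _ R _ mphi mu `](a + c), (b +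
  c)]%classic (EFin \o f).
rewrite /= => <- //.
- by apply: eq_measure_integral => A mA _; exact: lebesgue_measure_shift.
- exact/measurable_EFinP.
- rewrite -abE; apply: (@integrable_itv (f \o (fun x => x + c)) M) => //.
  by apply: measurableT_comp => //; exact: measurable_funD.
  by move=> x; exact: fM.
Qed.

(** For a shift e >= 0, both ]0, 1] and ]e, 1 + e] are obtained from ]0, 1 + e] by removing a piece,
    and the pieces ]1, 1 + e] and ]0, e] are translates by 1. A negative shift is undone by the
    opposite shift of the translated function. *)
Lemma Rintegral01_periodic (f : R -> R) (M c : R) : measurable_fun setT f ->
  (forall x, `|f x| <= M) -> (forall x, f (x + 1) = f x) ->
  \int[mu]_(x in I01) f (x + c) = \int[mu]_(x in I01) f x.
Proof.
have pos (g : R -> R) (e : R) : measurable_fun setT g ->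
    (forall x, `|g x| <= M) -> (forall x, g (x + 1) = g x) -> 0 <= e ->
    \int[mu]_(x in I01) g (x + e) = \int[mu]_(x in I01) g x.
  move=> mg gM gp e0.
  have mge : measurable_fun setT (fun x : R => g (x + e)).
    by apply: measurableT_comp => //; exact: measurable_funD.
  rewrite -Rintegral_itv_obnd_cbnd; last exact: (integrable_itv (M := M)).
  rewrite -Rintegral_itv_obnd_cbnd; last exact: (integrable_itv (M := M)).
  rewrite (Rintegral_shift _ _ _ mg gM) add0r.
  have A := @Rintegral_itvB R g (BRight 0) (BRight (1 + e)) e.
  have B := @Rintegral_itvB R g (BRight 0) (BRight (1 + e)) 1.
  rewrite -A//; last first.
  - by rewrite bnd_simp lerDr.
  - exact: integrable_itv gM (mu_itv_oc _ _).
  apply/eqP; rewrite subr_eq; apply/eqP.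
  have := Rintegral_shift 0 e 1 mg gM.
  rewrite add0r (addrC e); under eq_Rintegral do rewrite gp.
  move=> ->; rewrite -B ?bnd_simp ?lerDl//;
    last exact: integrable_itv gM (mu_itv_oc _ _).
  by rewrite [RHS]addrC subrK.
move=> mf fM fp; have [c0|c0] := leP 0 c; first exact: pos.
rewrite -[LHS](pos _ (- c)) ?oppr_ge0 ?ltW//.
- by under eq_Rintegral do rewrite addrNK.
- by apply: measurableT_comp => //; exact: measurable_funD.
- by move=> x; rewrite addrAC.
Qed.

Lemma Rintegral01Zl (f : R -> R) (M c : R) : measurable_fun setT f ->
  (forall x, `|f x| <= M) ->
  \int[mu]_(x in I01) (c * f x) = c * \int[mu]_(x in I01) f x.
Proof. by move=> mf fM; rewrite RintegralZl//; exact: (integrable_itv (M := M)). Qed.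

Lemma eq_Rintegral01_countable (f g : R -> R) (N : set R) :
  measurable_fun setT f -> measurable_fun setT g -> countable N ->
  (forall x, 0 <= x <= 1 -> ~ N x -> f x = g x) ->
  \int[mu]_(x in I01) f x = \int[mu]_(x in I01) g x.
Proof.
move=> mf mg cN fg; rewrite /Rintegral; congr fine.
apply: ae_eq_integral => //.
- by apply/measurable_EFinP; exact: measurable_funTS.
- by apply/measurable_EFinP; exact: measurable_funTS.
exists N; split => //.
- exact: countable_measurable.
- exact: countable_lebesgue_measure0.
- move=> x /= /not_implyP[xI]; apply: contra_notP => Nx; congr EFin.
  by apply: fg => //; rewrite in_itv in xI.
Qed.
End PartialIntegrals.

Section CubeIntegral.
Variables (R : realType) (I : eqType).
Local Notation mu := (@lebesgue_measure R).
Implicit Types (G : (I -> R) -> R) (x : I -> R) (i j : I) (s : seq I).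

(* Measurability of G is tested along coordinatewise measurable maps into
   I -> R, so that no sigma-algebra on I -> R is needed. *)
Definition bounded_measurable G : Prop :=
  (exists M : R, forall x, `|G x| <= M) /\
  forall d (T : measurableType d) (X : T -> I -> R),
    (forall i, measurable_fun setT (fun t => X t i)) ->
    measurable_fun setT (fun t => G (X t)).

(** An operator on functions of all coordinates, so that iterated integrals compose and can be
    permuted; the base point supplies the coordinates that are not integrated. *)
Definition partial_integral i G x : R :=
  \int[mu]_(u in `[0%R, 1%R]) G [eta x with i |-> u].

Definition cube_integral s G : (I -> R) -> R := foldr partial_integral G s.

Lemma measurable_update d (T : measurableType d) (X : T -> I -> R) i :
  (forall j, measurable_fun setT (fun t => X t j)) ->
  forall j, measurable_fun setT (fun p : T * R => [eta X p.1 with i |-> p.2] j).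
Proof.
move=> mX j /=; case: eqP => _; first exact: measurable_snd.
exact: measurableT_comp (mX j) measurable_fst.
Qed.

Lemma measurable_line G x i : bounded_measurable G ->
  measurable_fun setT (fun u : R => G [eta x with i |-> u]).
Proof.
move=> [_ mG]; apply: mG => j /=; case: eqP => _;
  [exact: measurable_id|exact: measurable_cst].
Qed.

Lemma bounded_measurable_partial_integral i G :
  bounded_measurable G -> bounded_measurable (partial_integral i G).
Proof.
move=> nG; have [[M GM] mG] := nG; split.
  exists M => x; apply: normr_Rintegral01_le => //; exact: measurable_line.
move=> d T X mX.
apply: (@measurable_Rintegral01 _ _ _ (fun p => G [eta X p.1 with i |-> p.2]) M) => //.
by apply: mG; exact: measurable_update.
Qed.

Lemma bounded_measurable_cube_integral s G :
  bounded_measurable G -> bounded_measurable (cube_integral s G).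
Proof.
by move=> nG; elim: s => //= i s;
  exact: bounded_measurable_partial_integral.
Qed.

Lemma update_update x i u v : [eta [eta x with i |-> u] with i |-> v] =
  [eta x with i |-> v] :> (I -> R).
Proof. by apply/funext => k /=; case: eqP. Qed.

Lemma update_comm x i j u v : i != j ->
  [eta [eta x with i |-> u] with j |-> v] =
  [eta [eta x with j |-> v] with i |-> u] :> (I -> R).
Proof.
by move=> ij; apply/funext => k /=; case: eqP => // ->; case: eqP => // ji;
  rewrite ji eqxx in ij.
Qed.

Lemma partial_integral_comm i j G : bounded_measurable G ->
  partial_integral i (partial_integral j G) = partial_integral j (partial_integral i G).
Proof.
move=> [[M GM] mG]; have [->//|ij] := eqVneq i j.
apply/funext => x.
pose f (p : R * R) := G [eta [eta x with i |-> p.1] with j |-> p.2].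
have mf : measurable_fun setT f.
  apply: mG; apply: (@measurable_update _ _ (fun u : R => [eta x with i |-> u])) =>
    k /=.
  by case: eqP => _; [exact: measurable_id|exact: measurable_cst].
transitivity (\int[mu]_(u in `[0%R, 1%R]) \int[mu]_(v in `[0%R, 1%R]) f (u, v)).
  by [].
rewrite (Rintegral01_swap mf (M := M)); last by move=> p; exact: GM.
by apply: eq_Rintegral => v _; apply: eq_Rintegral => u _; rewrite /f update_comm.
Qed.

Lemma cube_integral_cat s1 s2 G :
  cube_integral (s1 ++ s2) G = cube_integral s1 (cube_integral s2 G).
Proof. exact: foldr_cat. Qed.

Lemma cube_integral_perm s1 s2 G : bounded_measurable G -> perm_eq s1 s2 ->
  cube_integral s1 G = cube_integral s2 G.
Proof.
move=> nG; have swap i s : cube_integral (rcons s i) G = cube_integral (i :: s) G.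
  elim: s => //= j s ->; rewrite partial_integral_comm//.
  exact: bounded_measurable_cube_integral.
elim: s1 s2 => [s2 /perm_size/esym/size0nil-> //|i s1 IH s2 p12].
have is2 : i \in s2 by rewrite -(perm_mem p12) mem_head.
have [t1 [t2 s2E]] : exists t1 t2, s2 = t1 ++ i :: t2.
  by have [t1 t2] := splitPr is2; exists t1, t2.
rewrite s2E; transitivity (cube_integral (i :: t1 ++ t2) G).
  rewrite /=; congr partial_integral; apply: IH.
  by rewrite -(perm_cons i) (perm_trans p12)// s2E perm_catC/= perm_cons perm_catC.
elim: t1 {s2E} => //= j t1 <-; rewrite partial_integral_comm//.
exact: bounded_measurable_cube_integral.
Qed.

Lemma cube_integral_update s G x i u : i \notin s ->
  cube_integral s (fun y => G [eta y with i |-> u]) x =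
  cube_integral s G [eta x with i |-> u].
Proof.
elim: s x => //= j s IH x; rewrite inE negb_or => /andP[ij is'].
rewrite /partial_integral; apply: eq_Rintegral => v _.
by rewrite IH// update_comm// eq_sym.
Qed.

Lemma unit_cube_integralE s G : uniq s ->
  unit_cube_integral s G = cube_integral s G (fun=> 0).
Proof.
elim: s G => //= i s IH G /andP[is' us]; rewrite /partial_integral.
by apply: eq_Rintegral => u _; rewrite IH// cube_integral_update.
Qed.

Lemma cube_integralZl s G c x : bounded_measurable G ->
  cube_integral s (fun y => c * G y) x = c * cube_integral s G x.
Proof.
move=> nG; elim: s x => //= i s IH x; rewrite /partial_integral.
have ncG := bounded_measurable_cube_integral s nG; have [[M cGM] _] := ncG.
rewrite -(Rintegral01Zl (M := M))//; last exact: measurable_line.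
by apply: eq_Rintegral => u _; rewrite IH.
Qed.

Lemma eq_cube_integral s G1 G2 x :
  (forall y, (forall i, i \in s -> 0 <= y i <= 1) ->
             (forall i, i \notin s -> y i = x i) -> G1 y = G2 y) ->
  cube_integral s G1 x = cube_integral s G2 x.
Proof.
elim: s x => [|i s IH] x /= G12; first by apply: G12.
rewrite /partial_integral; apply: eq_Rintegral => u; rewrite inE/= in_itv/= => uI.
apply: IH => y ys yx; apply: G12 => j.
  rewrite inE; have [js _|js] := boolP (j \in s); first exact: ys.
  by rewrite orbF => /eqP ->; have [is'|is'] := boolP (i \in s);
    [exact: ys|rewrite yx//= eqxx].
by rewrite inE negb_or => /andP[ji js]; rewrite yx//= (negbTE ji).
Qed.

Lemma cube_integral_indep s G x :
  (forall y1 y2, (forall i, i \notin s -> y1 i = y2 i) -> G y1 = G y2) ->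
  cube_integral s G x = G x.
Proof.
elim: s x => //= i s IH x GE; rewrite /partial_integral.
rewrite -[RHS]Rintegral01_cst; apply: eq_Rintegral => u _.
rewrite IH => [|y1 y2 y12]; apply: GE => j; rewrite inE negb_or => /andP[ji js].
  by rewrite /= (negbTE ji).
exact: y12.
Qed.

Lemma cube_integral_base_indep (D : pred I) s G x1 x2 :
  (forall y1 y2, {in D, y1 =1 y2} -> G y1 = G y2) ->
  (forall i, i \notin s -> D i -> x1 i = x2 i) ->
  cube_integral s G x1 = cube_integral s G x2.
Proof.
move=> GD; elim: s x1 x2 => [|i s IH] x1 x2 x12 /=; first by apply: GD => i Di;
  exact: x12.
apply: eq_Rintegral => u _; apply: IH => j js Dj /=; case: eqP => // /eqP ji.
by apply: x12 => //; rewrite inE negb_or ji.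
Qed.

Lemma cube_integral_shift s G (c : I -> R) x : bounded_measurable G ->
  (forall i y, i \in s -> G (fun j => y j + (j == i)%:R) = G y) ->
  (forall i, i \notin s -> c i = 0) -> uniq s ->
  cube_integral s (fun y => G (fun j => y j + c j)) x = cube_integral s G x.
Proof.
elim: s G c x => [|i s IH] G c x nG Gper c0 /=.
  by move=> _; congr G; apply/funext => j; rewrite c0 ?addr0.
move=> /andP[is' us]; have [[M GM] mG] := nG.
pose c' j := if j == i then 0 else c j.
(* The shift of coordinate i goes into the function and the shift of the others into [c'], to which
   the induction hypothesis applies; coordinate i is left to periodicity in one variable. *)
pose G' y := G (fun j => y j + (j == i)%:R * c i).
have nG' : bounded_measurable G'.
  split; first by exists M => y; exact: GM.
  move=> d T X mX; apply: (mG _ _ (fun t j => X t j + (j == i)%:R * c i)) => j.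
  by apply: measurable_funD; [exact: mX|exact: measurable_cst].
have shift1 z : cube_integral s (fun y => G (fun j => y j + c j)) z =
    cube_integral s G [eta z with i |-> z i + c i].
  transitivity (cube_integral s (fun y => G' (fun j => y j + c' j)) z).
    apply: eq_cube_integral => y _ _; congr G; apply/funext => j; rewrite /c'.
    by case: eqP => [->|_]; rewrite ?addr0 ?mul1r ?mul0r ?addr0.
  rewrite IH//.
  - rewrite -cube_integral_update//; apply: eq_cube_integral => y _ yz.
    congr G; apply/funext => j /=; case: eqP => [->|_]; rewrite ?mul0r ?addr0//.
    by rewrite mul1r yz.
  - move=> k y ks; rewrite -[RHS](Gper k _ _); last by rewrite inE ks orbT.
    by congr G; apply/funext => j; rewrite addrAC.
  - move=> j js; rewrite /c'; case: eqP => // /eqP ji; apply: c0.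
    by rewrite inE negb_or ji.
rewrite /partial_integral.
transitivity (\int[mu]_(u in `[0%R, 1%R]) cube_integral s G [eta x with i |-> u + c i]).
  by apply: eq_Rintegral => u _; rewrite shift1 update_update/= eqxx.
have ncG := bounded_measurable_cube_integral s nG; have [[N cGN] _] := ncG.
apply: (Rintegral01_periodic (f := fun u => cube_integral s G [eta x with i |-> u])
  (M := N)) => //.
- exact: measurable_line.
- move=> u; rewrite -!cube_integral_update//; apply: eq_cube_integral => y _ _.
  rewrite -[RHS](Gper i); last by rewrite mem_head.
  by congr G; apply/funext => j /=; case: eqP => _; rewrite ?addr0.
Qed.

(** With coordinate i integrated innermost, [L] is affine of slope k != 0 on every line in that
    direction, so it takes integer values at only countably many points of the line. *)
Lemma eq_cube_integral_off_integers s i G1 G2 (L : (I -> R) -> R) (k : R) x :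
  bounded_measurable G1 -> bounded_measurable G2 -> i \in s -> k != 0 ->
  (forall y u, L [eta y with i |-> u] = L [eta y with i |-> 0] + k * u) ->
  (forall y, (forall j, j \in s -> 0 <= y j <= 1) ->
     L y \isn't a Num.int -> G1 y = G2 y) ->
  cube_integral s G1 x = cube_integral s G2 x.
Proof.
move=> n1 n2 is' k0 LE G12.
have ps : perm_eq s (rem i s ++ [:: i]).
  by rewrite perm_sym perm_catC perm_sym; exact: perm_to_rem.
rewrite (cube_integral_perm n1 ps) (cube_integral_perm n2 ps) !cube_integral_cat/=.
apply: eq_cube_integral => y ys _.
apply: (@eq_Rintegral01_countable _ _ _
  (range (fun n : int => (n%:~R - L [eta y with i |-> 0]) / k))).
- exact: measurable_line.
- exact: measurable_line.
- by apply: (sub_countable (card_image_le _ _)); exact: countableP.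
move=> u u01 Nu; apply: G12 => [j js /=|].
  by case: eqP => [_//|/eqP ji]; apply: ys; rewrite rem_mem.
apply/negP => /intrP[n Ln]; apply: Nu; exists n => //.
by rewrite -Ln LE addrAC subrr add0r mulrC mulKf.
Qed.
End CubeIntegral.

(** * Integrals over cosets of subtori *)

Section HaarUniqueness.
Variables (R : realType) (I : eqType).

(** Two copies of the index set give the two parametrizations independent parameters. *)
Let glue (x z : I -> R) (t : I + I) : R :=
  match t with inl a => x a | inr a => z a end.

Let cube_integral_inl (s : seq I) (K : (I + I -> R) -> R) q :
  cube_integral (map inl s) K q =
  cube_integral s (fun x => K (glue x (q \o inr))) (q \o inl).
Proof.
elim: s q => [|i s IH] q /=; first by congr K; apply/funext => -[].
by apply: eq_Rintegral => u _; rewrite IH.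
Qed.

Let cube_integral_inr (s : seq I) (K : (I + I -> R) -> R) q :
  cube_integral (map inr s) K q =
  cube_integral s (fun z => K (glue (q \o inl) z)) (q \o inr).
Proof.
elim: s q => [|i s IH] q /=; first by congr K; apply/funext => -[].
by apply: eq_Rintegral => u _; rewrite IH.
Qed.

Lemma bounded_measurable_comp (J : eqType) (G : (I -> R) -> R) (f : (J -> R) ->
  I -> R) :
  bounded_measurable G ->
  (forall d (T : measurableType d) (X : T -> J -> R),
    (forall j, measurable_fun setT (fun t => X t j)) ->
    forall i, measurable_fun setT (fun t => f (X t) i)) ->
  bounded_measurable (G \o f).
Proof.
move=> [[M GM] mG] mf; split; first by exists M => x; exact: GM.
by move=> d T X mX; apply: (mG _ _ (fun t => f (X t))); exact: mf.
Qed.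

(** Integer entries ensure that adding 1 to a parameter changes every value by an integer. *)
Definition int_linear (s : seq I) (A : I -> I -> int) (x : I -> R) (a : I) : R :=
  \sum_(b <- s) (A a b)%:~R * x b.

Lemma int_linearD s A x y a :
  int_linear s A (fun b => x b + y b) a = int_linear s A x a + int_linear s A y a.
Proof. by rewrite -big_split; apply: eq_bigr => b _; rewrite mulrDr. Qed.

(* The integral of H over a coset of a subtorus does not depend on the
   parametrization of the coset: averaging over two parametrizations at once
   and using the translation invariance of either one gives both integrals. *)
Lemma cube_integral_coset (s : seq I) (H : (I -> R) -> R) (A B : I -> I -> int)
    (v0 v1 : I -> R) x :
  uniq s -> bounded_measurable H ->
  (forall y1 y2, {in s, y1 =1 y2} -> H y1 = H y2) ->
  (forall y (n : I -> int), H (fun a => y a + (n a)%:~R) = H y) ->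
  (forall z, exists u, {in s, int_linear s A u =1 int_linear s B z}) ->
  (forall z, exists u, {in s, forall a, v0 a + int_linear s A z a =
    v1 a + int_linear s B u a}) ->
  cube_integral s (fun y => H (fun a => v0 a + int_linear s A y a)) x =
  cube_integral s (fun y => H (fun a => v1 a + int_linear s B y a)) x.
Proof.
move=> us nH Hs Hper AB v01.
have mlin d (T : measurableType d) (X : T -> I -> R) (E : I -> I -> int) a :
    (forall j, measurable_fun setT (fun t => X t j)) ->
    measurable_fun setT (fun t => int_linear s E (X t) a).
  move=> mX; apply: measurable_sum => b; apply: measurable_funM; last exact: mX.
  exact: measurable_cst.
have nlin (E : I -> I -> int) (v : I -> R) :
    bounded_measurable (fun y => H (fun a => v a + int_linear s E y a)).
  apply: (bounded_measurable_comp (f := fun y a => v a + int_linear s E y a)) => //.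
  by move=> d T X mX a; apply: measurable_funD; [exact: measurable_cst|exact: mlin].
have shift (E : I -> I -> int) (v u : I -> R) y :
    cube_integral s (fun y => H (fun a =>
      v a + int_linear s E y a + int_linear s E u a)) y =
    cube_integral s (fun y => H (fun a => v a + int_linear s E y a)) y.
  pose u' a := if a \in s then u a else 0.
  rewrite -[RHS](cube_integral_shift (c := u'))//.
  - apply: eq_cube_integral => z _ _; congr H; apply/funext => a.
    rewrite int_linearD addrA; congr (_ + _).
    by rewrite /int_linear !big_seq; apply: eq_bigr => b bs; rewrite /u' bs.
  (* A unit step of parameter b adds the integer column b of [E], which [Hper] absorbs. *)
  - move=> b z bs; rewrite -[RHS](Hper _ (E ^~ b)); congr H; apply/funext => a.
    rewrite int_linearD addrA; congr (_ + _); rewrite /int_linear (bigD1_seq b)//=.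
    rewrite eqxx mulr1 big1 ?addr0// => c /negbTE ->; exact: mulr0.
  - by move=> a /negbTE; rewrite /u' => ->.
have indep (E : I -> I -> int) (v : I -> R) y z :
    cube_integral s (fun y => H (fun a => v a + int_linear s E y a)) y =
    cube_integral s (fun y => H (fun a => v a + int_linear s E y a)) z.
  apply: (@cube_integral_base_indep _ _ (mem s)) => [y1 y2 y12|a /negP as' //].
  apply: Hs => a _; congr (_ + _); rewrite /int_linear !big_seq.
  by apply: eq_bigr => b bs; rewrite y12.
pose K (q : I + I -> R) := H (fun a => v0 a + int_linear s A (q \o inl) a +
  int_linear s B (q \o inr) a).
have nK : bounded_measurable K.
  apply: (bounded_measurable_comp (f := fun q a => v0 a +
    int_linear s A (q \o inl) a + int_linear s B (q \o inr) a)) => //.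
  move=> d T X mX a; apply: measurable_funD; first apply: measurable_funD.
  - exact: measurable_cst.
  - by apply: (mlin _ _ (fun t => X t \o inl)) => j; exact: mX.
  - by apply: (mlin _ _ (fun t => X t \o inr)) => j; exact: mX.
have EA : cube_integral (map inl s) K =
    cst (cube_integral s (fun y => H (fun a => v0 a + int_linear s A y a)) x).
  apply/funext => q; rewrite cube_integral_inl /cst (indep _ _ x (q \o inl)).
  (* For a fixed right parameter, the displacement along [B] is one along [A], which translating the
     left parameter removes. *)
  have [u uE] := AB (q \o inr); rewrite -[RHS](shift _ _ u).
  by apply: eq_cube_integral => y _ _; apply: Hs => a as'; rewrite uE.
have EB : cube_integral (map inr s) K =
    cst (cube_integral s (fun y => H (fun a => v1 a + int_linear s B y a)) x).
  apply/funext => q; rewrite cube_integral_inr /cst (indep _ _ x (q \o inr)).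
  (* For a fixed left parameter, the point of the first coset is a point of the second one, with
     parameter [u]; a translation removes [u]. *)
  have [u uE] := v01 (q \o inl); rewrite -[RHS](shift _ _ u).
  by apply: eq_cube_integral => y _ _; apply: Hs => a as'; rewrite /= uE// addrAC.
have EBA := cube_integral_perm nK (permEl (perm_catC (map inl s) (map inr s))).
move: EBA; rewrite !cube_integral_cat EA EB {EA EB}.
set c0 := cube_integral s _ x; set c1 := cube_integral s _ x => EBA.
have := congr1 (fun f : (I + I -> R) -> R => f (fun=> 0)) EBA.
by rewrite !cube_integral_indep.
Qed.
End HaarUniqueness.

(** * Identity theorem for meromorphic functions *)

Section OneVariable.
Variable R : realType.
Local Notation C := R[i].

(** The norm of [R[i]] takes values in [R[i]]; a real-valued modulus keeps the estimates in [R]. *)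
Definition nrm (z : C) : R := ComplexField.Normc.normc z.

Lemma normE (z : C) : `|z| = (nrm z)%:C.
Proof. by case: z => a b; rewrite normc_def. Qed.

Lemma nrm_ge0 (z : C) : 0 <= nrm z.
Proof. by rewrite -ler0c -normE normr_ge0. Qed.

Lemma nrmD (x y : C) : nrm (x + y) <= nrm x + nrm y.
Proof. by rewrite -lecR rmorphD/= -!normE ler_normD. Qed.

Lemma nrmM (x y : C) : nrm (x * y) = nrm x * nrm y.
Proof. exact: ComplexField.Normc.normcM. Qed.

Lemma nrmX (x : C) n : nrm (x ^+ n) = nrm x ^+ n.
Proof.
elim: n => [|n IH]; last by rewrite !exprS nrmM IH.
by rewrite !expr0; exact: ComplexField.Normc.normc1.
Qed.

Lemma nrmN (x : C) : nrm (- x) = nrm x.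
Proof. by apply: (@complexI R); rewrite -!normE normrN. Qed.

Lemma nrm0 : nrm 0 = 0.
Proof. exact: ComplexField.Normc.normc0. Qed.

Lemma nrm_eq0 (x : C) : (nrm x == 0) = (x == 0).
Proof. by rewrite -(inj_eq (@complexI R)) -normE rmorph0 normr_eq0. Qed.

Lemma nrmC (x : R) : nrm x%:C = `|x|.
Proof. by rewrite /= expr0n/= addr0 sqrtr_sqr. Qed.

Lemma nrmB (x y : C) : nrm (x - y) = nrm (y - x).
Proof. by rewrite -nrmN opprB. Qed.

Lemma nrm_triangle (y x z : C) : nrm (x - z) <= nrm (x - y) + nrm (y - z).
Proof. by rewrite (le_trans _ (nrmD _ _))// addrA subrK. Qed.

Lemma nrm_sum (J : Type) (s : seq J) (F : J -> C) :
  nrm (\sum_(j <- s) F j) <= \sum_(j <- s) nrm (F j).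
Proof.
elim: s => [|j s IH]; first by rewrite !big_nil nrm0.
by rewrite !big_cons (le_trans (nrmD _ _))// lerD2l.
Qed.

Implicit Types (f g : C -> C) (s u : C).

Definition psum (a : nat -> C) (u : C) N : C := \sum_(0 <= n < N) a n * u ^+ n.

(** An explicit geometric remainder bound replaces convergence: products and the identity theorem
    then need only finite partial sums. *)
Definition taylor f s (a : nat -> C) (M rho : R) : Prop :=
  forall u, nrm u < rho ->
    forall N, nrm (f (s + u) - psum a u N) <= M * (nrm u / rho) ^+ N.

Definition analytic_at f s : Prop := exists a M rho, 0 < rho /\ taylor f s a M rho.

Lemma taylor_bound_ge0 f s a M rho : 0 < rho -> taylor f s a M rho -> 0 <= M.
Proof.
move=> r0 tf; have := tf 0; rewrite nrm0 => /(_ r0 0%N); rewrite expr0 mulr1.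
exact: le_trans (nrm_ge0 _).
Qed.

Lemma taylor_shrink f s a M rho r : 0 < r -> r <= rho ->
  taylor f s a M rho -> taylor f s a M r.
Proof.
move=> r0 rrho tf u ur N; apply: (le_trans (tf u (lt_le_trans ur rrho) N)).
have M0 := taylor_bound_ge0 (lt_le_trans r0 rrho) tf.
apply: ler_wpM2l => //; apply: lerXn2r.
- by rewrite nnegrE divr_ge0 ?nrm_ge0// (le_trans (ltW r0) rrho).
- by rewrite nnegrE divr_ge0 ?nrm_ge0// ltW.
- by rewrite ler_wpM2l ?nrm_ge0// lef_pV2// posrE (lt_le_trans r0).
Qed.

Lemma analytic_at_sub f g s : analytic_at f s -> analytic_at g s ->
  analytic_at (fun u => f u - g u) s.
Proof.
move=> [a [M [r [r0 tf]]]] [b [N [p [p0 tg]]]].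
have m0 : 0 < Num.min r p by rewrite lt_min r0.
exists (fun n => a n - b n), (M + N), (Num.min r p); split=> // u um n.
have -> : psum (fun n => a n - b n) u n = psum a u n - psum b u n.
  by rewrite /psum -sumrB; apply: eq_bigr => i _; rewrite mulrBl.
rewrite opprB addrACA -opprB opprK.
rewrite (_ : _ - _ = (f (s + u) - psum a u n) + - (g (s + u) - psum b u n));
  last by ring.
rewrite (le_trans (nrmD _ _))// nrmN mulrDl lerD//.
  by apply: (taylor_shrink m0 _ tf) => //; rewrite ge_min lexx.
by apply: (taylor_shrink m0 _ tg) => //; rewrite ge_min lexx orbT.
Qed.

(** Truncating the second factor at N - i keeps exactly the terms of degree less than N, the form in
    which remainders of products can be estimated. *)
Lemma psum_cauchy (a b : nat -> C) u N :
  psum (fun n => \sum_(0 <= i < n.+1) a i * b (n - i)%N) u N =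
  \sum_(0 <= i < N) a i * u ^+ i * psum b u (N - i).
Proof.
elim: N => [|N IH]; first by rewrite /psum !big_geq.
rewrite [LHS]/psum big_nat_recr//= -/(psum _ _ _) IH [RHS]big_nat_recr//= subSnn.
rewrite [psum b u 1]/psum big_nat1 expr0 mulr1.
rewrite big_nat_recr//= subnn mulrDl addrA; congr (_ + _); last by ring.
rewrite big_distrl -big_split/=.
apply: eq_big_nat => i /andP[_ iN].
rewrite subSn ?(ltnW iN)// /psum big_nat_recr//= mulrDr; congr (_ + _).
have -> : u ^+ N = u ^+ i * u ^+ (N - i) by rewrite -exprD subnKC// ltnW.
ring.
Qed.

Lemma analytic_at_mul f g s : analytic_at f s -> analytic_at g s ->
  analytic_at (fun u => f u * g u) s.
Proof.
move=> [a [M [r1 [r10 tf]]]] [b [M' [r2 [r20 tg]]]].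
pose r := Num.min r1 r2; have r0 : 0 < r by rewrite lt_min r10.
have {}tf : taylor f s a M r by apply: (taylor_shrink r0 _ tf); rewrite ge_min lexx.
have {}tg : taylor g s b M' r by apply: (taylor_shrink r0 _ tg);
  rewrite ge_min lexx orbT.
have M0 := taylor_bound_ge0 r0 tf.
have M'0 := taylor_bound_ge0 r0 tg.
(* The remainder below splits into N terms of size 2 M M' q^N and one of size M M' q^N; as 2N + 1 <=
   3 * 2^N, halving the radius absorbs the factor 2N + 1. *)
exists (fun n => \sum_(0 <= i < n.+1) a i * b (n - i)%N), (3 * M * M'), (r / 2).
split; first by rewrite divr_gt0.
move=> u ur N; pose q := nrm u / r.
have q0 : 0 <= q by rewrite divr_ge0 ?nrm_ge0// ltW.
have ur' : nrm u < r by apply: (lt_trans ur); rewrite ltr_pdivrMr// mulrDr mulr1 ltrDl.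
have q1 : q <= 1 by rewrite ler_pdivrMr// mul1r ltW.
(* A term is the difference of two consecutive remainders, and q <= 1. *)
have aiE i : nrm (a i * u ^+ i) <= 2 * M * q ^+ i.
  have -> : a i * u ^+ i = psum a u i.+1 - psum a u i.
    by rewrite /psum big_nat_recr//= addrAC subrr add0r.
  apply: (le_trans (nrm_triangle (f (s + u)) _ _)).
  rewrite nrmB; have := tf u ur' i; have := tf u ur' i.+1; rewrite -/q => A B.
  apply: (le_trans (lerD A B)); rewrite -mulrA mulrDl mul1r lerD2r exprS.
  by rewrite ler_wpM2l// ler_piMl// exprn_ge0.
rewrite psum_cauchy.
rewrite (_ : _ - _ = \sum_(0 <= i < N) a i * u ^+ i * (g (s + u) - psum b u (N - i)) +
  (f (s + u) - psum a u N) * g (s + u)); last first.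
  under [in RHS]eq_bigr do rewrite mulrBr.
  by rewrite sumrB -big_distrl/= -/(psum a u N); ring.
rewrite (le_trans (nrmD _ _))//.
have -> : nrm u / (r / 2) = 2 * q by rewrite /q; field; rewrite gt_eqF.
apply: (@le_trans _ _ (2 * M * M' * q ^+ N *+ N + M * M' * q ^+ N)).
  apply: lerD.
    rewrite (le_trans (nrm_sum _ _))//.
    rewrite -[X in _ *+ X]subn0 -sumr_const_nat.
    apply: ler_sum_nat => i /andP[_ iN]; rewrite nrmM.
    apply: (le_trans (ler_pM (nrm_ge0 _) (nrm_ge0 _) (aiE i) (tg u ur' (N - i)%N))).
    have -> : q ^+ N = q ^+ i * q ^+ (N - i) by rewrite -exprD subnKC// ltnW.
    by rewrite -/q le_eqVlt; apply/orP; left; apply/eqP; ring.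
  rewrite nrmM -mulrA [M' * _]mulrC mulrA.
  apply: ler_pM; rewrite ?nrm_ge0//; first exact: tf.
  by have := tg u ur' 0%N; rewrite /psum big_geq// subr0 expr0 mulr1.
rewrite [(2 * q) ^+ N]exprMn.
have N2 : N.*2.+1%:R <= 3 * 2 ^+ N :> R.
  rewrite -natrX -natrM ler_nat. 
  elim: {q1 aiE} N => // n IH; rewrite doubleS expnS. lia.
rewrite (_ : _ + _ = M * M' * q ^+ N * N.*2.+1%:R); last first.
  by rewrite -[X in X + _ = _]mulr_natr -[N.*2.+1]addn1 natrD -mul2n natrM; ring.
rewrite [leRHS](_ : _ = M * M' * q ^+ N * (3 * 2 ^+ N)); last by ring.
by apply: ler_wpM2l => //; rewrite !mulr_ge0// exprn_ge0.
Qed.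

End OneVariable.

Section OneVariableIdentity.
Variable R : realType.
Local Notation C := R[i].
Implicit Types (f g : C -> C) (s u : C).

Definition vanishes_near f s : Prop :=
  exists2 d : R, 0 < d & forall u, nrm u < d -> f (s + u) = 0.

Definition zeros_cluster f s : Prop :=
  forall d : R, 0 < d -> exists u, [/\ u != 0, nrm u < d & f (s + u) = 0].

(** At a zero u near 0, the first nonzero term a_n u^n would be bounded by a remainder of order
    |u|^(n+1). *)
Lemma taylor_zero f s a M rho : 0 < rho -> taylor f s a M rho ->
  zeros_cluster f s -> forall n, a n = 0.
Proof.
move=> r0 tf zf; elim/ltn_ind => n IH.
have M0 := taylor_bound_ge0 r0 tf.
apply/eqP; rewrite -nrm_eq0; apply/negPn/negP => an0.
have an : 0 < nrm (a n) by rewrite lt_def an0 nrm_ge0.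
(* Below this threshold the remainder is smaller than |a_n u^n|; M + 1 replaces M, which may be
   0. *)
pose d := Num.min rho (nrm (a n) * rho ^+ n.+1 / (M + 1)).
have d0 : 0 < d by rewrite lt_min r0 divr_gt0// ?mulr_gt0 ?exprn_gt0// ltr_wpDl.
have [u [u0 ud fu]] := zf d d0.
have nu : 0 < nrm u by rewrite lt_def nrm_eq0 u0 nrm_ge0.
have urho : nrm u < rho by apply: (lt_le_trans ud); rewrite ge_min lexx.
have := tf u urho n.+1.
rewrite fu sub0r nrmN /psum big_nat_recr//= big1_seq ?add0r; last first.
  by move=> i /andP[_]; rewrite mem_index_iota => /andP[_ /IH->]; rewrite mul0r.
rewrite nrmM nrmX leNgt => /negP; apply.
rewrite expr_div_n [nrm u ^+ n.+1]exprS.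
rewrite (_ : M * _ = M * nrm u / rho ^+ n.+1 * nrm u ^+ n); last by ring.
rewrite ltr_pM2r ?exprn_gt0//.
have : nrm u < nrm (a n) * rho ^+ n.+1 / (M + 1).
  by apply: (lt_le_trans ud); rewrite ge_min lexx orbT.
rewrite ltr_pdivlMr ?ltr_wpDl// => H.
rewrite ltr_pdivrMr ?exprn_gt0//.
apply: le_lt_trans H; rewrite mulrC mulrDr mulr1 lerDl; exact: nrm_ge0.
Qed.

(** All coefficients vanish, so on half the radius the remainder bound reads |f| <= M 2^-N for every
    N. *)
Lemma analytic_zeros f s : analytic_at f s -> zeros_cluster f s -> vanishes_near f s.
Proof.
move=> [a [M [rho [r0 tf]]]] zf; have a0 := taylor_zero r0 tf zf.
have M0 := taylor_bound_ge0 r0 tf.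
exists (rho / 2); first by rewrite divr_gt0.
move=> u ur; have ur' : nrm u < rho by apply: (lt_trans ur);
  rewrite ltr_pdivrMr// mulrDr mulr1 ltrDl.
apply/eqP; rewrite -nrm_eq0; apply/negPn/negP => fu0.
have fu : 0 < nrm (f (s + u)) by rewrite lt_def fu0 nrm_ge0.
(* Then M / N is less than the supposedly nonzero |f|, and 2^-N <= 1/N gives the contradiction. *)
pose N := (Num.truncn (M / nrm (f (s + u)))).+1.
have := tf u ur' N; rewrite /psum big1 ?subr0; last by move=> i _; rewrite a0 mul0r.
rewrite leNgt => /negP; apply.
have MN : M < N%:R * nrm (f (s + u)).
  by rewrite -ltr_pdivrMr// truncnS_gt.
have q0 : 0 <= nrm u / rho by rewrite divr_ge0 ?nrm_ge0// ltW.
have qN : (nrm u / rho) ^+ N <= N%:R^-1.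
  apply: (@le_trans _ _ ((2^-1) ^+ N)).
    apply: lerXn2r; rewrite ?nnegrE ?invr_ge0// ler_pdivrMr// mulrC; exact: ltW.
  rewrite exprVn lef_pV2 ?posrE ?exprn_gt0// ?ltr0n//.
  by rewrite -natrX ler_nat ltnW// ltn_expl.
apply: (@le_lt_trans _ _ (M * N%:R^-1)); first exact: ler_wpM2l.
by rewrite ltr_pdivrMr ?ltr0n// mulrC.
Qed.

Lemma analytic_at_eq0 f s : analytic_at f s -> zeros_cluster f s -> f s = 0.
Proof.
move=> /analytic_zeros h /h[d d0 /(_ 0)]; rewrite nrm0 addr0; exact.
Qed.

(** If the zeros of [f] do not cluster at [s], then [f] is nonzero on a punctured disc, on which [g]
    must vanish near [s]. *)
Lemma mul_vanishes_near f g s : vanishes_near (fun u => f u * g u) s ->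
  zeros_cluster f s \/ zeros_cluster g s.
Proof.
move=> [d d0 fg]; have [zf|nzf] := pselect (zeros_cluster f s); first by left.
right => e e0.
have [c c0 cf] : exists2 c : R, 0 < c & forall u, u != 0 -> nrm u < c -> f (s + u) != 0.
  apply: contrapT => H; apply: nzf => c c0; apply: contrapT => K.
  apply: H; exists c => // u u0 uc; apply/negP => /eqP fu; apply: K; exists u.
  by split.
pose r := Num.min (Num.min c d) e / 2.
have m0 : 0 < Num.min (Num.min c d) e by rewrite !lt_min c0 d0.
have r0 : 0 < r by rewrite divr_gt0.
have rm : r < Num.min (Num.min c d) e by rewrite ltr_pdivrMr// mulrDr mulr1 ltrDl.
have nr : nrm r%:C = r by rewrite nrmC gtr0_norm.
have rC0 : r%:C != 0 by rewrite -nrm_eq0 nr gt_eqF.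
move: rm; rewrite !lt_min => /andP[/andP[rc rd] re].
exists r%:C; rewrite nr; split => //.
have := fg r%:C; rewrite nr => /(_ rd) /eqP; rewrite mulf_eq0 => /orP[|/eqP//].
by rewrite (negbTE (cf _ rC0 _))// nr.
Qed.

(** Connectedness of [0, 1] in inductive form: the supremum of the s for which Q holds on [0, s] is
    attained by the left step and cannot be below 1 by the right step. *)
Lemma real_induction (Q : R -> Prop) : Q 0 ->
  (forall s : R, 0 <= s <= 1 -> Q s ->
    exists2 e : R, 0 < e & forall t, s < t < s + e -> Q t) ->
  (forall s : R, 0 < s <= 1 -> (forall t, 0 <= t < s -> Q t) -> Q s) ->
  Q 1.
Proof.
move=> Q0 Qr Ql.
pose S := [set s : R | 0 <= s <= 1 /\ forall t, 0 <= t <= s -> Q t].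
have S0 : S 0.
  by split; rewrite ?lexx ?ler01// => t t0; rewrite (_ : t = 0)//; apply/eqP;
    rewrite eq_le andbC.
have hS : has_sup S by split; [exists 0|exists 1 => s [/andP[]]].
pose m := sup S.
have m0 : 0 <= m by apply: ub_le_sup => //; case: hS.
have m1 : m <= 1 by apply: ge_sup; [exists 0|move=> s [/andP[]]].
have Qlt t : 0 <= t < m -> Q t.
  move=> /andP[t0 tm]; have mt : 0 < m - t by rewrite subr_gt0.
  have [s [_ Ss] ts] := sup_adherent mt hS; apply: Ss; rewrite t0 ltW//.
  by move: ts; rewrite /= opprB addrC subrK.
have Qm : Q m.
  move: m0; rewrite le_eqVlt => /orP[/eqP<-//|m0].
  by apply: Ql => //; rewrite m0.
have Sm : S m.
  split; first by rewrite m0.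
  move=> t /andP[t0]; rewrite le_eqVlt => /orP[/eqP->//|tm].
  by apply: Qlt; rewrite t0.
have [e e0 Qe] := Qr m (introT andP (conj m0 m1)) Qm.
move: m1; rewrite le_eqVlt => /orP[/eqP<-//|m1].
pose t := Num.min 1 (m + e / 2).
have mt : m < t by rewrite lt_min m1 ltrDl divr_gt0.
have tme : t < m + e.
  by rewrite gt_min; apply/orP; right; rewrite ltrD2l ltr_pdivrMr// mulrDr mulr1 ltrDl.
suff St : S t by have := ub_le_sup hS.2 St; rewrite leNgt mt.
split; first by rewrite (le_trans m0 (ltW mt))/= ge_min lexx.
move=> x /andP[x0 xt]; have [xm|mx] := leP x m; first by case: Sm => _; apply;
  rewrite x0.
by apply: Qe; rewrite mx (le_lt_trans xt).
Qed.

(** Vanishing near s persists for points slightly to the right; at a limit from the left, the zeros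
    already found cluster and analyticity takes over. *)
Lemma line_identity f : (forall s : R, 0 <= s <= 1 -> analytic_at f s%:C) ->
  vanishes_near f 0 -> f 1 = 0.
Proof.
move=> af f0.
suff [d d0 /(_ 0)] : vanishes_near f (1 : R)%:C by rewrite nrm0 addr0 => /(_ d0).
apply: (real_induction (Q := fun s : R => vanishes_near f s%:C)) => //.
  move=> s s01 [d d0 fd]; exists d => // t /andP[st td].
  exists (s + d - t); first by rewrite subr_gt0.
  move=> u ut; rewrite -[t%:C](subrK s%:C) [_ + s%:C]addrC -addrA; apply: fd.
  rewrite -rmorphB (le_lt_trans (nrmD _ _))// nrmC gtr0_norm ?subr_gt0//.
  move: ut; lra.
move=> s /andP[s0 s1] fs; apply: analytic_zeros; first by apply: af; rewrite ltW.
move=> d d0; pose r := Num.min s (d / 2).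
have r0 : 0 < r by rewrite lt_min s0 divr_gt0.
have nr : nrm (- r)%:C = r by rewrite nrmC normrN gtr0_norm.
exists (- r)%:C; split.
- by rewrite -nrm_eq0 nr gt_eqF.
- rewrite nr gt_min; apply/orP; right.
  by rewrite ltr_pdivrMr// mulrDr mulr1 ltrDl.
- rewrite -rmorphD; have : 0 <= s - r < s.
    by rewrite subr_ge0 ge_min lexx/= ltrBlDr ltrDl.
  by move=> /fs[e e0 /(_ 0)]; rewrite nrm0 addr0; apply.
Qed.
End OneVariableIdentity.

(** * Power series in several variables and their restrictions to lines *)

Section SeveralVariables.
Variables (R : realType) (I : finType).
Local Notation C := R[i].
Local Notation pt := {ffun I -> C}.
Local Notation midx := {ffun I -> nat}.
Implicit Types (f g h : pt -> C) (p q z v : pt) (s u : C).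

(** Abel's argument: convergence at one point u0 bounds the terms |a_n| u0^n, and on the disc of
    radius u0 / 2 the tails are dominated by a geometric series. *)
Lemma taylor_of_partial_sums (f : C -> C) s (a : nat -> C) (r : R) : 0 < r ->
  (forall u, nrm u < r -> forall e : R, 0 < e ->
     exists N0, forall N, (N0 <= N)%N -> nrm (psum a u N - f (s + u)) < e) ->
  analytic_at f s.
Proof.
move=> r0 cvg.
pose u0 := r / 2; have u00 : 0 < u0 by rewrite divr_gt0.
have nu0 : nrm u0%:C = u0 by rewrite nrmC gtr0_norm.
have u0r : nrm u0%:C < r by rewrite nu0 ltr_pdivrMr// mulrDr mulr1 ltrDl.
clearbody u0.
have [N0 cN0] := cvg _ u0r 1 ltr01.
(* From [N0] on, a term is the difference of two partial sums within 1 of the limit, hence at most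
   2; the finite sum bounds the earlier terms. *)
pose M := 2 + \sum_(0 <= n < N0) nrm (a n) * u0 ^+ n.
have M0 : 0 <= M by rewrite addr_ge0// sumr_ge0// => n _;
  rewrite mulr_ge0 ?nrm_ge0// exprn_ge0// ltW.
have aM n : nrm (a n) * u0 ^+ n <= M.
  have [N0n|nN0] := leqP N0 n.
    have E : a n * u0%:C ^+ n = psum a u0%:C n.+1 - psum a u0%:C n.
      by rewrite /psum big_nat_recr//= addrAC subrr add0r.
    have -> : nrm (a n) * u0 ^+ n = nrm (a n * u0%:C ^+ n) by rewrite nrmM nrmX nu0.
    rewrite E (le_trans (nrm_triangle (f (s + u0%:C)) _ _))//.
    rewrite [X in _ + X]nrmB.
    apply: (@le_trans _ _ (1 + 1)); first by rewrite lerD// ltW// cN0// ltnW.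
    rewrite /M -natr1 lerDl sumr_ge0// => i _; rewrite mulr_ge0 ?nrm_ge0// exprn_ge0//.
    exact: ltW.
  rewrite /M (bigD1_seq n) ?mem_index_iota ?iota_uniq//=.
  rewrite addrCA lerDl addr_ge0// sumr_ge0// => i _;
    rewrite mulr_ge0 ?nrm_ge0// exprn_ge0//.
  exact: ltW.
exists a, (2 * M), (u0 / 2); split; first by rewrite divr_gt0.
move=> u uu N; pose q := nrm u / u0.
have q0 : 0 <= q by rewrite divr_ge0 ?nrm_ge0// ltW.
have q2 : q <= 2^-1 by rewrite ler_pdivrMr// mulrC ltW.
have ur : nrm u < r.
  by apply: (lt_trans uu); rewrite -nu0; apply: lt_trans u0r;
    rewrite nu0 ltr_pdivrMr// mulrDr mulr1 ltrDl.
have -> : nrm u / (u0 / 2) = 2 * q by rewrite /q; field; rewrite gt_eqF.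
(* The factor 1 - 2^-n makes the induction on n go through, using q <= 1/2. *)
have tail n : nrm (psum a u (N + n) - psum a u N) <= 2 * M * q ^+ N * (1 - 2^-1 ^+ n).
  elim: n => [|n IH]; first by rewrite addn0 subrr nrm0 expr0 subrr mulr0.
  rewrite addnS {1}/psum big_nat_recr//= -/(psum _ _ _) addrAC.
  apply: (le_trans (nrmD _ _)); apply: (le_trans (lerD IH (lexx _))).
  have : nrm (a (N + n)%N * u ^+ (N + n)) <= M * (q ^+ N * 2^-1 ^+ n).
    rewrite nrmM nrmX (_ : nrm (a (N + n)%N) * _ =
      nrm (a (N + n)%N) * u0 ^+ (N + n) * q ^+ (N + n)).
      rewrite ler_pM ?mulr_ge0 ?nrm_ge0 ?exprn_ge0// ?(ltW u00)//.
      by rewrite exprD ler_wpM2l ?exprn_ge0// lerXn2r ?nnegrE ?invr_ge0.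
    have U0 : u0 ^+ (N + n) != 0 by rewrite expf_neq0// gt_eqF.
    rewrite /q expr_div_n; move: (u0 ^+ (N + n)) U0 => U U0; field.
    exact: U0.
  rewrite exprS; set X := nrm _; set Y := 2^-1 ^+ n; set Z := q ^+ N;
    move: X Y Z => X Y Z.
  nra.
clearbody q.
have tail' n : nrm (psum a u (N + n) - psum a u N) <= 2 * M * (2 * q) ^+ N.
  apply: (le_trans (tail n)); rewrite -mulrA ler_wpM2l ?mulr_ge0//.
  rewrite -[leRHS]mulr1; apply: ler_pM; rewrite ?exprn_ge0//.
  - by rewrite subr_ge0 exprn_ile1 ?invr_ge0 ?invf_le1 ?ler1n.
  - apply: lerXn2r; rewrite ?nnegrE ?mulr_ge0//.
    by rewrite mulrDl mul1r lerDl.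
apply/ler_addgt0Pr => e e0; have [N1 cN1] := cvg _ ur e e0.
rewrite (le_trans (nrm_triangle (psum a u (N + N1)) _ _))// addrC lerD//.
by rewrite nrmB ltW// cN1// leq_addl.
Qed.

Lemma multi_sum_toP (a : midx -> C) (l : C) : multi_sum_to a l <->
  forall e : R, 0 < e -> exists A : {fset midx}, forall B : {fset midx}, A `<=` B ->
    nrm (\sum_(k <- B) a k - l) < e.
Proof.
have FT : ProperFilter (@totally midx) by exact: totally_filter.
split => [/cvgrPdist_lt al e e0|al].
  have e0C : 0 < e%:C by rewrite ltcR.
  have [A _ AB] := al e%:C e0C; exists A => B /AB /=; rewrite normE ltcR nrmB.
  by rewrite /partial_sum big_seq_fsetE.
apply/cvgrPdist_lt => e e0; have eR : e = (complex.Re e)%:C.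
  by rewrite RRe_real// gtr0_real.
have /al[A AB] : 0 < complex.Re e by rewrite -ltcR -eR.
exists A => // B /AB; rewrite /= normE eR ltcR nrmB /partial_sum big_seq_fsetE.
exact.
Qed.

Lemma multi_sum_to_unique (a : midx -> C) (l1 l2 : C) :
  multi_sum_to a l1 -> multi_sum_to a l2 -> l1 = l2.
Proof.
move=> /multi_sum_toP a1 /multi_sum_toP a2; apply/eqP; rewrite -subr_eq0 -nrm_eq0.
apply/negPn/negP => l0; have e0 : 0 < nrm (l1 - l2) / 2.
  by rewrite divr_gt0// lt_def l0 nrm_ge0.
have [A1 h1] := a1 _ e0; have [A2 h2] := a2 _ e0.
have := h1 (A1 `|` A2) (fsubsetUl _ _); have := h2 (A1 `|` A2) (fsubsetUr _ _).
move=> b2 b1; have := nrm_triangle (\sum_(k <- A1 `|` A2) a k) l1 l2.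
rewrite [nrm (l1 - bigop _ _ _)]nrmB => /le_lt_trans /(_ (ltrD b1 b2)).
by rewrite -splitr ltxx.
Qed.

Lemma multi_sum_to_reindex (a : midx -> C) (l : C) (phi psi : midx -> midx) :
  cancel phi psi -> cancel psi phi ->
  multi_sum_to a l -> multi_sum_to (a \o phi) l.
Proof.
move=> phiK psiK /multi_sum_toP al; apply/multi_sum_toP => e /al[A AB].
exists [fset psi k | k in A] => B AB'.
have -> : \sum_(k <- B) (a \o phi) k = \sum_(k <- [fset phi k | k in B]) a k.
  by rewrite big_imfset//= => x y _ _; exact: (can_inj phiK).
apply: AB; apply/fsubsetP => k kA; apply/imfsetP; exists (psi k); rewrite ?psiK//.
by apply: (fsubsetP AB'); apply/imfsetP; exists k.
Qed.

Definition mdeg (k : midx) : nat := \sum_i k i.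

(** Multi-indices with entries below N are enumerated only to obtain a finite set. *)
Definition mdeg_lt N : {fset midx} :=
  [fset k in [seq [ffun i => nat_of_ord ((b : {ffun I -> 'I_N}) i)] : midx |
     b <- enum {ffun I -> 'I_N}] | (mdeg k < N)%N].

Lemma in_mdeg_lt N k : (k \in mdeg_lt N) = (mdeg k < N)%N.
Proof.
rewrite /mdeg_lt !inE/= andbC; apply: andb_idr => kN.
have ki i : (k i < N)%N by apply: leq_ltn_trans kN; rewrite /mdeg (bigD1 i)//= leq_addr.
apply/mapP; exists [ffun i => Ordinal (ki i)]; first by rewrite mem_enum.
by apply/ffunP => i; rewrite !ffunE.
Qed.

Lemma sum_mdeg_lt N (F : midx -> C) :
  \sum_(k <- mdeg_lt N) F k =
  \sum_(0 <= n < N) \sum_(k <- mdeg_lt n.+1 | mdeg k == n) F k.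
Proof.
rewrite big_mkord; rewrite big_seq.
transitivity (\sum_(n < N) \sum_(k <- mdeg_lt N | mdeg k == n) F k).
  rewrite -big_seq.
  rewrite (exchange_big_dep xpredT)//= big_seq [RHS]big_seq; apply: eq_bigr => k.
  rewrite in_mdeg_lt => kN; rewrite (big_pred1 (Ordinal kN))//.
apply: eq_bigr => n _; rewrite -[LHS]big_filter -[RHS]big_filter; apply: perm_big.
apply: uniq_perm; rewrite ?filter_uniq ?fset_uniq// => k.
rewrite !mem_filter !in_mdeg_lt; case: eqP => //= ->.
by rewrite ltn_ord ltnSn.
Qed.

Lemma in_polydiscP p (e : R) z : in_polydisc p e z <-> forall i, nrm (z i - p i) < e.
Proof. by split=> pz i; have := pz i; rewrite normE ltcR. Qed.

Definition line z v u : pt := [ffun i => z i + u * v i].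

Lemma lineD z v s u : line (line z v s) v u = line z v (s + u).
Proof. by apply/ffunP => i; rewrite !ffunE mulrDl addrA. Qed.

Lemma line0 z v : line z v 0 = z.
Proof. by apply/ffunP => i; rewrite !ffunE mul0r addr0. Qed.

Lemma line1 z q : line z (q - z) 1 = q.
Proof. by apply/ffunP => i; rewrite !ffunE mul1r addrC subrK. Qed.

Lemma in_polydisc_line_near q (e : R) z v : in_polydisc q e z ->
  exists2 d : R, 0 < d & forall u, nrm u < d -> in_polydisc q e (line z v u).
Proof.
move=> /in_polydiscP zq.
(* A parameter u moves each coordinate by at most |u| V, and [m] is a positive margin available in
   all of them. *)
pose V := 1 + \sum_i nrm (v i).
have V0 : 0 < V by rewrite ltr_pwDl// sumr_ge0// => i _; exact: nrm_ge0.
pose m := \big[Num.min/1]_i (e - nrm (z i - q i)).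
have m0 : 0 < m.
  apply: (big_ind (fun x => 0 < x)) => // [x y x0 y0|i _]; first by rewrite lt_min x0.
  by rewrite subr_gt0.
exists (m / V); first by rewrite divr_gt0.
move=> u ud; apply/in_polydiscP => i; rewrite ffunE addrAC.
apply: (le_lt_trans (nrmD _ _)); rewrite [ltLHS]addrC -ltrBrDr nrmM.
apply: (@lt_le_trans _ _ m); last exact: (@bigmin_le _ _ _ 1 i).
apply: (@le_lt_trans _ _ (nrm u * V)); last by rewrite -ltr_pdivlMr.
rewrite ler_wpM2l ?nrm_ge0// /V (bigD1 i)//= addrCA lerDl addr_ge0// sumr_ge0// => j _.
exact: nrm_ge0.
Qed.

(** All that the identity theorem uses of holomorphy; it passes to products by the one-variable
    case, with no multiplication of multi-index series. *)
Definition line_analytic_at g z : Prop :=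
  forall z0 v s, line z0 v s = z -> analytic_at (fun u => g (line z0 v u)) s.

(** Unconditional convergence allows grouping by total degree: the homogeneous component of degree
    n, evaluated at [v], is the n-th coefficient along the line. *)
Lemma holomorphic_line_analytic g z : holomorphic_at g z -> line_analytic_at g z.
Proof.
move=> [e [c [e0 gz]]] z0 v s zE.
have [d d0 dz] : exists2 d : R, 0 < d & forall u, nrm u < d ->
  in_polydisc z e (line z v u).
  by apply: in_polydisc_line_near; apply/in_polydiscP => i; rewrite subrr nrm0.
pose a n := \sum_(k <- mdeg_lt n.+1 | mdeg k == n) c k * \prod_i v i ^+ k i.
apply: (@taylor_of_partial_sums _ _ a d) => // u ud r r0.
have /multi_sum_toP/(_ r r0)[A AB] := gz _ (dz u ud).
rewrite -zE lineD in AB.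
(* The sets [mdeg_lt N] eventually contain any finite set of multi-indices. *)
exists (\max_(k <- A) mdeg k).+1 => N AN.
have -> : psum a u N =
  \sum_(k <- mdeg_lt N) c k * \prod_i (line z0 v (s + u) i - line z0 v s i) ^+ k i.
  rewrite sum_mdeg_lt; apply: eq_bigr => n _; rewrite /a big_distrl/=.
  apply: eq_bigr => k /eqP kn; rewrite -mulrA; congr (_ * _).
  rewrite -kn /mdeg -prodrXr -big_split/=; apply: eq_bigr => i _.
  rewrite !ffunE opprD addrACA subrr add0r -mulrBl addrAC subrr add0r exprMn.
  exact: mulrC.
apply: AB; apply/fsubsetP => k kA; rewrite in_mdeg_lt.
by apply: leq_trans AN; rewrite ltnS; exact: (@leq_bigmax_seq _ _ xpredT).
Qed.
End SeveralVariables.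

(** * Propagation of equality along real segments *)

Section MeromorphicIdentity.
Variables (R : realType) (I : finType).
Local Notation C := R[i].
Local Notation pt := {ffun I -> C}.
Implicit Types (f g h : pt -> C) (p q z v : pt) (s u : C) (e : R).

Lemma line_analytic_mul g h z : line_analytic_at g z -> line_analytic_at h z ->
  line_analytic_at (fun z => g z * h z) z.
Proof. by move=> ag ah z0 v s zE; apply: analytic_at_mul; [exact: ag|exact: ah]. Qed.

Lemma line_analytic_sub g h z : line_analytic_at g z -> line_analytic_at h z ->
  line_analytic_at (fun z => g z - h z) z.
Proof. by move=> ag ah z0 v s zE; apply: analytic_at_sub; [exact: ag|exact: ah]. Qed.

Lemma line_analytic_cst (c : C) z : line_analytic_at (fun=> c) z.
Proof.
move=> z0 v s _; exists (fun n => if n == 0%N then c else 0), (nrm c), 1.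
split=> // u _ [|N]; first by rewrite /psum big_geq// subr0 expr0 mulr1.
rewrite /psum big_nat_recl//= expr0 mulr1 big1 ?addr0 ?subrr ?nrm0.
  by rewrite mulr_ge0 ?nrm_ge0// exprn_ge0// divr_ge0 ?nrm_ge0.
by move=> i _; rewrite mul0r.
Qed.

Lemma in_polydisc_segment q e z1 z2 (s : R) : 0 <= s <= 1 ->
  in_polydisc q e z1 -> in_polydisc q e z2 -> in_polydisc q e (line z1 (z2 - z1) s%:C).
Proof.
move=> /andP[s0 s1] /in_polydiscP z1q /in_polydiscP z2q; apply/in_polydiscP => i.
rewrite !ffunE (_ : _ - _ = (1 - s)%:C * (z1 i - q i) + s%:C * (z2 i - q i));
  last first.
  by rewrite rmorphB rmorph1; ring.
rewrite (le_lt_trans (nrmD _ _))// !nrmM !nrmC !ger0_norm ?subr_ge0//.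
have [->|sN0] := eqVneq s 0; first by rewrite subr0 mul1r mul0r addr0.
have sp : 0 < s by rewrite lt_def sN0.
have A : (1 - s) * nrm (z1 i - q i) <= (1 - s) * e by rewrite ler_wpM2l ?subr_ge0// ltW.
have B : s * nrm (z2 i - q i) < s * e by rewrite ltr_pM2l.
by move: A B; lra.
Qed.

Definition line_analytic_on g q e := forall z, in_polydisc q e z ->
  line_analytic_at g z.

Lemma polydisc_line_identity g q e z1 z2 : line_analytic_on g q e ->
  in_polydisc q e z1 -> in_polydisc q e z2 ->
  vanishes_near (fun u => g (line z1 (z2 - z1) u)) 0 -> g z2 = 0.
Proof.
move=> ag z1q z2q v0; rewrite -(line1 z1 z2).
apply: (line_identity (f := fun u => g (line z1 (z2 - z1) u))) => // s s01.
by apply: (ag (line z1 (z2 - z1) s%:C)) => //; exact: in_polydisc_segment.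
Qed.

Lemma line_analytic_eq0 g z v : line_analytic_at g z ->
  zeros_cluster (fun u => g (line z v u)) 0 -> g z = 0.
Proof.
move=> ag zg; rewrite -(line0 z v).
by apply: (analytic_at_eq0 (f := fun u => g (line z v u))) zg; apply: ag; rewrite line0.
Qed.

(** On the line from a point with g != 0 to one with h != 0, a vanishing product would make the
    zeros of one factor cluster at the first point: impossible for g, and for h this spreads to the
    second point. *)
Lemma polydisc_mul_neq0 g h q e :
  line_analytic_on g q e -> line_analytic_on h q e ->
  (exists2 z, in_polydisc q e z & g z != 0) ->
  (exists2 z, in_polydisc q e z & h z != 0) ->
  exists2 z, in_polydisc q e z & g z * h z != 0.
Proof.
move=> ag ah [z1 z1q /eqP gz1] [z2 z2q /eqP hz2]; apply: contrapT => gh0.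
have [d d0 dq] := in_polydisc_line_near (z2 - z1) z1q.
have : vanishes_near (fun u => g (line z1 (z2 - z1) u) * h (line z1 (z2 - z1) u)) 0.
  exists d => // u ud; apply/eqP/negPn/negP => gh; apply: gh0.
  by exists (line z1 (z2 - z1) u) => //; rewrite -[u]add0r; move: gh;
    rewrite add0r => gh; [exact: dq|].
move=> /mul_vanishes_near[zg|zh].
  by apply: gz1; apply: line_analytic_eq0 zg; exact: ag.
apply: hz2; apply: (polydisc_line_identity ah z1q z2q); apply: analytic_zeros zh.
by apply: (ah z1) => //; rewrite line0.
Qed.

(** If g vanished on the small polydisc, vanishing would spread along the segment from its centre to
    [z]. *)
Lemma polydisc_neq0_sub g q e q' e' : line_analytic_on g q e ->
  0 < e' -> (forall z, in_polydisc q' e' z -> in_polydisc q e z) ->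
  (exists2 z, in_polydisc q e z & g z != 0) ->
  exists2 z, in_polydisc q' e' z & g z != 0.
Proof.
move=> ag e'0 sub [z zq gz]; apply: contrapT => g0.
have q'q' : in_polydisc q' e' q' by apply/in_polydiscP => i; rewrite subrr nrm0.
have [d d0 dq] := in_polydisc_line_near (z - q') q'q'.
move/eqP: gz; apply; apply: (polydisc_line_identity ag (sub _ q'q') zq).
exists d => // u ud; rewrite add0r; apply/eqP/negPn/negP => gu; apply: g0.
by exists (line q' (z - q') u) => //; exact: dq.
Qed.

(** The values of a meromorphic function at zeros of its local denominators are arbitrary; equality
    off the zeros of a nonzero analytic function is insensitive to them. *)
Definition generically_eq f1 f2 q : Prop := exists e h,
  [/\ 0 < e, line_analytic_on h q e, exists2 z, in_polydisc q e z & h z != 0 &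
      forall z, in_polydisc q e z -> h z != 0 -> f1 z = f2 z].

Lemma sub_half_polydisc q q' e e' : in_polydisc q (e / 2) q' -> e' <= e / 2 ->
  forall z, in_polydisc q' e' z -> in_polydisc q e z.
Proof.
move=> /in_polydiscP q'q e'e z /in_polydiscP zq'; apply/in_polydiscP => i.
rewrite (le_lt_trans (nrm_triangle (q' i) _ _))//.
by have := q'q i; have := zq' i; move: e'e; lra.
Qed.

Lemma generically_eq_open f1 f2 q : generically_eq f1 f2 q ->
  exists2 e, 0 < e & forall q', in_polydisc q e q' -> generically_eq f1 f2 q'.
Proof.
move=> [e [h [e0 ah hN0 f12]]]; exists (e / 2); first by rewrite divr_gt0.
move=> q' q'q; have sub := sub_half_polydisc q'q (lexx _).
exists (e / 2), h; split; first by rewrite divr_gt0.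
- by move=> z /sub; exact: ah.
- by apply: polydisc_neq0_sub sub hN0; rewrite ?divr_gt0.
- by move=> z /sub; exact: f12.
Qed.

(** Near q write f_i = g_i / h_i. Generic equality at one nearby point forces g_1 h_2 - g_2 h_1 to
    vanish on the whole polydisc. *)
Lemma generically_eq_closed f1 f2 q : meromorphic f1 -> meromorphic f2 ->
  exists2 e, 0 < e & forall q', in_polydisc q e q' ->
    generically_eq f1 f2 q' -> generically_eq f1 f2 q.
Proof.
move=> /(_ q)[e1 [g1 [h1 [e10 a1 h1N0 f1E]]]] /(_ q)[e2 [g2 [h2 [e20 a2 h2N0 f2E]]]].
pose e := Num.min e1 e2; have e0 : 0 < e by rewrite lt_min e10.
have sub1 z : in_polydisc q e z -> in_polydisc q e1 z.
  by move=> /in_polydiscP H; apply/in_polydiscP => i; apply: (lt_le_trans (H i));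
    rewrite ge_min lexx.
have sub2 z : in_polydisc q e z -> in_polydisc q e2 z.
  by move=> /in_polydiscP H; apply/in_polydiscP => i; apply: (lt_le_trans (H i));
    rewrite ge_min lexx orbT.
have ag1 : line_analytic_on g1 q e by move=> z /sub1/a1[/holomorphic_line_analytic].
have ah1' : line_analytic_on h1 q e1 by move=> z /a1[_ /holomorphic_line_analytic].
have ag2 : line_analytic_on g2 q e by move=> z /sub2/a2[/holomorphic_line_analytic].
have ah2' : line_analytic_on h2 q e2 by move=> z /a2[_ /holomorphic_line_analytic].
have {}h1N0 := polydisc_neq0_sub ah1' e0 sub1 h1N0.
have {}h2N0 := polydisc_neq0_sub ah2' e0 sub2 h2N0.
have ah1 : line_analytic_on h1 q e by move=> z /sub1/ah1'.
have ah2 : line_analytic_on h2 q e by move=> z /sub2/ah2'.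
pose h z := h1 z * h2 z.
have ah : line_analytic_on h q e.
  by move=> z zq; apply: line_analytic_mul; [exact: ah1|exact: ah2].
have hN0 := polydisc_mul_neq0 ah1 ah2 h1N0 h2N0.
pose G z := g1 z * h2 z - g2 z * h1 z.
have aG : line_analytic_on G q e.
  move=> z zq; apply: line_analytic_sub; apply: line_analytic_mul;
    by [exact: ag1|exact: ag2|exact: ah1|exact: ah2].
exists (e / 2); first by rewrite divr_gt0.
move=> q' q'q [e' [h' [e'0 ah' h'N0 f12]]].
suff G0 z : in_polydisc q e z -> G z = 0.
  exists e, h; split=> // z zq; rewrite /h mulf_eq0 negb_or => /andP[h1z h2z].
  rewrite f1E ?f2E//; [|exact: sub2|exact: sub1].
  by apply/eqP; rewrite eqr_div// -subr_eq0; apply/eqP; exact: G0.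
pose e'' := Num.min e' (e / 2); have e''0 : 0 < e'' by rewrite lt_min e'0 divr_gt0.
have sub : forall z, in_polydisc q' e'' z -> in_polydisc q e z.
  by apply: sub_half_polydisc => //; rewrite ge_min lexx orbT.
have sub' z' : in_polydisc q' e'' z' -> in_polydisc q' e' z'.
  by move=> /in_polydiscP H; apply/in_polydiscP => i; apply: (lt_le_trans (H i));
    rewrite ge_min lexx.
move=> zq; apply/eqP/negPn/negP => Gz.
have GN0 : exists2 z, in_polydisc q' e'' z & G z != 0.
  by apply: (polydisc_neq0_sub aG) => //; exists z.
have hN0' := polydisc_neq0_sub ah e''0 sub hN0.
have h'N0' := polydisc_neq0_sub ah' e''0 sub' h'N0.
have aG'' : line_analytic_on G q' e'' by move=> x /sub/aG.
have ah'' : line_analytic_on h q' e'' by move=> x /sub/ah.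
have ah''' : line_analytic_on h' q' e'' by move=> x /sub'/ah'.
have hh'N0 := polydisc_mul_neq0 ah'' ah''' hN0' h'N0'.
have ahh' : line_analytic_on (fun z => h z * h' z) q' e''.
  by move=> x xq; apply: line_analytic_mul; [exact: ah''|exact: ah'''].
(* A point where [G] and all denominators are nonzero; there f1 = f2 amounts to G = 0. *)
have [x xq] := polydisc_mul_neq0 aG'' ahh' GN0 hh'N0.
rewrite !mulf_eq0 !negb_or => /andP[Gx /andP[/andP[h1x h2x] h'x]].
move/eqP: Gx; apply; have := f12 x (sub' _ xq) h'x.
rewrite f1E ?f2E//; [|exact/sub2/sub|exact/sub1/sub].
by move=> /eqP; rewrite eqr_div// -subr_eq0 => /eqP.
Qed.

(** On the line from p to a point with h != 0 the zeros of h cannot cluster at p, so those of f1 -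
    f2 do. *)
Lemma holomorphic_eq_of_generically_eq f1 f2 p : generically_eq f1 f2 p ->
  holomorphic_at f1 p -> holomorphic_at f2 p -> f1 p = f2 p.
Proof.
move=> [e [h [e0 ah [z zp hz] f12]]] /holomorphic_line_analytic a1
  /holomorphic_line_analytic a2.
have pp : in_polydisc p e p by apply/in_polydiscP => i; rewrite subrr nrm0.
have [d d0 dp] := in_polydisc_line_near (z - p) pp.
apply/eqP; rewrite -subr_eq0; apply/eqP.
have : vanishes_near (fun u =>
  (f1 (line p (z - p) u) - f2 (line p (z - p) u)) * h (line p (z - p) u)) 0.
  exists d => // u ud; rewrite add0r; have [->|hu] := eqVneq (h (line p (z - p) u)) 0.
    by rewrite mulr0.
  by rewrite f12 ?subrr ?mul0r//; exact: dp.
move=> /mul_vanishes_near[zf|zh].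
  apply: (line_analytic_eq0 (g := fun z => f1 z - f2 z)) zf; exact: line_analytic_sub.
exfalso; move/eqP: hz; apply; apply: (polydisc_line_identity ah pp zp).
by apply: analytic_zeros zh; apply: (ah p) => //; rewrite line0.
Qed.

(** Real induction on the segment from 0 to p: generic equality is open, and closed by
    meromorphy. *)
Lemma meromorphic_identity f1 f2 (d : R) : 0 < d ->
  meromorphic f1 -> meromorphic f2 ->
  (forall z, in_polydisc [ffun=> 0] d z -> f1 z = f2 z) ->
  forall p, holomorphic_at f1 p -> holomorphic_at f2 p -> f1 p = f2 p.
Proof.
move=> d0 m1 m2 f12 p; apply: holomorphic_eq_of_generically_eq.
pose P (s : R) := generically_eq f1 f2 (line [ffun=> 0] p s%:C).
have near e (s : R) : 0 < e -> exists2 c : R, 0 < c & forall t : R, `|t - s| < c ->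
    in_polydisc (line [ffun=> 0] p s%:C) e (line [ffun=> 0] p t%:C).
  move=> e0; have : in_polydisc (line [ffun=> 0] p s%:C) e (line [ffun=> 0] p s%:C).
    by apply/in_polydiscP => i; rewrite subrr nrm0.
  move=> /(in_polydisc_line_near p)[c c0 cs]; exists c => // t ts.
  by have := cs (t - s)%:C; rewrite nrmC lineD -rmorphD [s + _]addrC subrK; exact.
suff : P 1 by rewrite /P (_ : line _ _ _ = p)//; apply/ffunP => i;
  rewrite !ffunE mul1r add0r.
apply: real_induction.
- rewrite /P line0; exists d, (fun=> 1); split=> //.
  + by move=> z _; exact: line_analytic_cst.
  + by exists [ffun=> 0]; rewrite ?oner_eq0//; apply/in_polydiscP => i;
    rewrite subrr nrm0.
  + by move=> z zd _; exact: f12.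
- move=> s _ /generically_eq_open[e e0 eP]; have [c c0 cs] := near e s e0.
  exists c => // t /andP[st tc]; apply: eP; apply: cs.
  by rewrite gtr0_norm ?subr_gt0// ltrBlDl.
- move=> s /andP[s0 s1] Pt.
  have [e e0 eP] := generically_eq_closed (line [ffun=> 0] p s%:C) m1 m2.
  have [c c0 cs] := near e s e0.
  pose t := Num.max 0 (s - c / 2).
  have ts : t < s by rewrite gt_max s0 ltrBlDr ltrDl divr_gt0.
  apply: (eP (line [ffun=> 0] p t%:C)); last by apply: Pt; rewrite ts le_max lexx.
  apply: cs; rewrite ltr0_norm ?subr_lt0// opprB ltrBlDl -ltrBlDr lt_max; apply/orP;
    right.
  by rewrite ltrD2l ltrN2 ltr_pdivrMr// mulrDr mulr1 ltrDl.
Qed.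
End MeromorphicIdentity.

(** * Invariance of holomorphy and meromorphy under signed permutations of the variables *)

Section SignedPermutation.
Variables (R : realType) (I : finType) (tau tau' : I -> I).
Variable eps : I -> R[i].
Hypotheses (tauK : cancel tau tau') (tau'K : cancel tau' tau).
Hypothesis eps1 : forall i, nrm (eps i) = 1.
Local Notation C := R[i].
Local Notation pt := {ffun I -> C}.
Implicit Types (f g h : pt -> C) (p z : pt).

(** The form taken by the action of an automorphism on t, with [tau] a permutation of the positive
    roots and [eps] a family of signs. *)
Definition signed_perm z : pt := [ffun i => eps i * z (tau i)].

Let phi (k : {ffun I -> nat}) : {ffun I -> nat} := [ffun i => k (tau i)].
Let psi (k : {ffun I -> nat}) : {ffun I -> nat} := [ffun i => k (tau' i)].

Let phiK : cancel phi psi.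
Proof. by move=> k; apply/ffunP => i; rewrite !ffunE tau'K. Qed.
Let psiK : cancel psi phi.
Proof. by move=> k; apply/ffunP => i; rewrite !ffunE tauK. Qed.

Lemma in_polydisc_signed_perm p e z : in_polydisc (signed_perm p) e (signed_perm z)
  <-> in_polydisc p e z.
Proof.
rewrite !in_polydiscP; split=> H i.
  have := H (tau' i); rewrite !ffunE tau'K -mulrBr nrmM eps1 mul1r; exact.
by rewrite !ffunE -mulrBr nrmM eps1 mul1r; exact: H.
Qed.

Lemma holomorphic_signed_perm f p : holomorphic_at f (signed_perm p) ->
  holomorphic_at (f \o signed_perm) p.
Proof.
move=> [e [c [e0 fc]]]; exists e, (fun k => c (phi k) * \prod_i eps i ^+ phi k i);
  split=> // z zp.
have := fc (signed_perm z) ((in_polydisc_signed_perm _ _ _).2 zp).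
move=> /(multi_sum_to_reindex phiK psiK); congr multi_sum_to; apply/funext => k /=.
rewrite -mulrA; congr (_ * _);
  rewrite [X in _ = _ * X](reindex_inj (can_inj tauK)) -big_split/=.
by apply: eq_bigr => i _; rewrite !ffunE -mulrBr exprMn.
Qed.

Lemma signed_perm_surj z : exists z', signed_perm z' = z.
Proof.
have eps0 i : eps i != 0 by rewrite -nrm_eq0 eps1 oner_eq0.
exists [ffun i => (eps (tau' i))^-1 * z (tau' i)].
by apply/ffunP => i; rewrite !ffunE tauK mulVKf.
Qed.

Lemma meromorphic_signed_perm f : meromorphic f -> meromorphic (f \o signed_perm).
Proof.
move=> mf p; have [e [g [h [e0 gh [z zp hz] fE]]]] := mf (signed_perm p).
exists e, (g \o signed_perm), (h \o signed_perm); split=> //.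
- move=> x /(in_polydisc_signed_perm _ _ _).2 /gh[/holomorphic_signed_perm ?
  /holomorphic_signed_perm ?].
  by split.
- have [z' zE] := signed_perm_surj z; exists z'; last by rewrite /= zE.
  by apply/in_polydisc_signed_perm; rewrite zE.
- by move=> x /(in_polydisc_signed_perm _ _ _).2 /fE.
Qed.
End SignedPermutation.

(** * Root systems *)

Section RootFacts.
Variables (R : realType) (V : vectType R) (dot : {dot V for idfun}).

Lemma dotC u v : dot u v = dot v u.
Proof. by rewrite hermC expr0 mul1r. Qed.

Lemma dotZl c u v : dot (c *: u) v = c * dot u v.
Proof. by rewrite linearZl_LR. Qed.

Lemma dotZr c u v : dot u (c *: v) = c * dot u v.
Proof. by rewrite dotC dotZl dotC. Qed.

Lemma dotDl u1 u2 v : dot (u1 + u2) v = dot u1 v + dot u2 v.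
Proof. by rewrite linearDl. Qed.

Lemma dotDr u v1 v2 : dot u (v1 + v2) = dot u v1 + dot u v2.
Proof. by rewrite dotC dotDl !(dotC u). Qed.

Lemma dotNl u v : dot (- u) v = - dot u v.
Proof. by rewrite -scaleN1r dotZl mulN1r. Qed.

Lemma dotNr u v : dot u (- v) = - dot u v.
Proof. by rewrite dotC dotNl dotC. Qed.

Lemma dotBl u1 u2 v : dot (u1 - u2) v = dot u1 v - dot u2 v.
Proof. by rewrite dotDl dotNl. Qed.

Lemma dotBr u v1 v2 : dot u (v1 - v2) = dot u v1 - dot u v2.
Proof. by rewrite dotDr dotNr. Qed.

Lemma dot0l v : dot 0 v = 0.
Proof. by rewrite -(scale0r 0) dotZl mul0r. Qed.

Lemma dot_suml (J : Type) (s : seq J) (P : pred J) (F : J -> V) v :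
  dot (\sum_(j <- s | P j) F j) v = \sum_(j <- s | P j) dot (F j) v.
Proof. by apply: (big_morph (dot^~ v) (fun x y => dotDl x y v) (dot0l v)). Qed.

Lemma dot_gt0 u : u != 0 -> 0 < dot u u.
Proof. exact: neq0_dnorm_gt0. Qed.

Lemma corootZ c a : c != 0 -> coroot dot (c *: a) = c^-1 *: coroot dot a.
Proof.
move=> c0; rewrite /coroot dotZl dotZr !scalerA; congr (_ *: _).
have [->|a0] := eqVneq (dot a a) 0; first by rewrite !mulr0 invr0 !mulr0 mul0r.
by field; rewrite a0.
Qed.

Lemma corootN a : coroot dot (- a) = - coroot dot a.
Proof. by rewrite -scaleN1r corootZ ?oppr_eq0 ?oner_eq0// invrN1 scaleN1r. Qed.

Lemma dot_coroot a v : dot (coroot dot a) v = 2 * dot a v / dot a a.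
Proof. by rewrite /coroot dotZl mulrAC. Qed.

Lemma dot_corootK a : a != 0 -> dot (coroot dot a) a = 2.
Proof. by move=> /dot_gt0 a0; rewrite dot_coroot mulfK// gt_eqF. Qed.

Lemma reflectionE a v : reflection dot a v = v - dot a v *: coroot dot a.
Proof. by rewrite /reflection dot_coroot /coroot scalerA; congr (_ - _ *: _); ring. Qed.

Lemma reflection_isometry a u v : a != 0 ->
  dot (reflection dot a u) (reflection dot a v) = dot u v.
Proof.
move=> /dot_gt0 a0;
  rewrite /reflection /coroot !(dotBl, dotBr, dotZl, dotZr) (dotC u a).
by field; rewrite gt_eqF.
Qed.

Lemma reflectionD a u v : reflection dot a (u + v) =
  reflection dot a u + reflection dot a v.
Proof. by rewrite /reflection dotDr scalerDl opprD addrACA. Qed.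

Lemma reflectionZ a c v : reflection dot a (c *: v) = c *: reflection dot a v.
Proof. by rewrite /reflection dotZr scalerBr scalerA. Qed.

Lemma reflection_self a : a != 0 -> reflection dot a a = - a.
Proof.
by move=> a0;
  rewrite /reflection dot_corootK// mulr2n scalerDl scale1r opprD addrA subrr sub0r.
Qed.

Lemma coroot_reflection a b : a != 0 ->
  coroot dot (reflection dot a b) = reflection dot a (coroot dot b).
Proof. by move=> a0; rewrite /coroot reflection_isometry// reflectionZ. Qed.

Lemma reflectionK a : a != 0 -> involutive (reflection dot a).
Proof.
move=> a0 v; rewrite {2}/reflection -scaleNr reflectionD reflectionZ reflection_self//.
by rewrite scalerN scaleNr opprK /reflection subrK.
Qed.

Section Root.
Variable D : {fset V}.
Hypotheses (D_root : root_system dot D).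

Lemma root_neq a : a \in D -> a != 0.
Proof. by move=> aD; apply: contraTneq aD => ->; exact: root_neq0 D_root. Qed.

Lemma root_opp a : a \in D -> - a \in D.
Proof.
by move=> aD; rewrite -(reflection_self (root_neq aD));
  exact: (root_reflection D_root).
Qed.

Lemma root_span_ind (Q : V -> Prop) : Q 0 -> (forall c u v, Q u -> Q v ->
  Q (c *: u + v)) ->
  (forall a, a \in D -> Q a) -> forall v, Q v.
Proof.
move=> Q0 Qlin QD v.
have : v \in <<in_tuple (enum_fset D)>>%VS by rewrite in_tupleE (root_span D_root)
  memvf.
move=> /coord_span ->; elim/big_ind: _ => // [x y Qx Qy|i _].
  by rewrite -[x]scale1r; exact: Qlin.
by rewrite -[_ *: _]addr0; apply: Qlin => //; apply: QD; exact: mem_nth.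
Qed.

Section Automorphism.
Variables (w : 'End(V)) (w_Aut : Aut D w).

Lemma Aut_inj : injective w.
Proof. by apply/lker0P; rewrite w_Aut.1. Qed.

Lemma Aut_root a : a \in D -> w a \in D.
Proof. by move=> aD; rewrite -[X in _ \in X]w_Aut.2; apply/imfsetP; exists a. Qed.

Lemma Aut_root_surj a : a \in D -> exists2 b, b \in D & a = w b.
Proof. by rewrite -{1}w_Aut.2 => /imfsetP. Qed.

Lemma Aut_invK : cancel w (w^-1)%VF.
Proof. by apply: lker0_lfunK; rewrite w_Aut.1. Qed.

Lemma Aut_inv_linK : cancel (w^-1)%VF w.
Proof.
have limg : limg w = fullv.
  apply/eqP; rewrite eqEdim subvf/= limg_dim_eq// w_Aut.1.
  by rewrite capv0.
by move=> v; apply: limg_lfunVK; rewrite limg memvf.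
Qed.

Lemma Aut_inv : Aut D (w^-1)%VF.
Proof.
split.
  by apply/eqP/lker0P => u v uv; rewrite -[u]Aut_inv_linK uv Aut_inv_linK.
apply/fsetP => a; apply/imfsetP/idP => [[b /= bD ->]|aD].
  by have [c cD ->] := Aut_root_surj bD; rewrite Aut_invK.
by exists (w a); rewrite ?Aut_invK//; exact: Aut_root.
Qed.

Lemma Aut_invV : ((w^-1)^-1)%VF = w.
Proof.
apply/lfunP => v.
have K : cancel (w^-1)%VF ((w^-1)^-1)%VF.
  by apply: lker0_lfunK; rewrite Aut_inv.1.
by rewrite -{1}[v]Aut_invK K.
Qed.

(* Both w s_a w^-1 and the reflection in w a send w a to its opposite and
   preserve D, so their quotient is a unipotent map permuting the finite D. *)
Lemma Aut_cartan a b : a \in D -> b \in D ->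
  dot (coroot dot (w a)) (w b) = dot (coroot dot a) b.
Proof.
move=> aD bD; have waD := Aut_root aD; have wa0 := root_neq waD.
apply/eqP; rewrite -subr_eq0 -oppr_eq0 opprB.
set d := _ - _; apply/negPn/negP => d0.
pose T v := reflection dot (w a) (w (reflection dot a ((w^-1)%VF v))).
have TD v : v \in D -> T v \in D.
  move=> vD; apply: (root_reflection D_root) => //; apply: Aut_root.
  apply: (root_reflection D_root) => //; have [c cD ->] := Aut_root_surj vD.
  by rewrite Aut_invK.
(* [T] fixes w a and adds d times w a to w b, so d != 0 would produce infinitely many roots. *)
have Tb k : T (w b + (k * d) *: w a) = w b + ((k + 1) * d) *: w a.
  rewrite /T.
  have -> : (w^-1)%VF (w b + (k * d) *: w a) = b + (k * d) *: a.
    by rewrite linearD linearZ/= !Aut_invK.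
  have -> : reflection dot a (b + (k * d) *: a) =
    b - (dot (coroot dot a) b + k * d) *: a.
    rewrite reflectionD reflectionZ reflection_self ?root_neq// /reflection.
    by rewrite scalerN scalerDl opprD addrA.
  rewrite linearB linearZ/= -scaleNr reflectionD reflectionZ reflection_self//.
  rewrite /reflection scalerN scaleNr opprK -addrA -scaleNr -scalerDl.
  by congr (_ + _ *: _); rewrite /d; ring.
have inD (k : nat) : w b + (k%:R * d) *: w a \in D.
  elim: k => [|k IH]; first by rewrite mul0r scale0r addr0 Aut_root.
  by rewrite -natr1 -Tb; exact: TD.
pose F (k : nat) := w b + (k%:R * d) *: w a.
have Finj : injective F.
  move=> k l /addrI /eqP; rewrite -subr_eq0 -scalerBl scaler_eq0 (negbTE wa0) orbF.
  by rewrite -mulrBl mulf_eq0 (negbTE d0) orbF subr_eq0 eqr_nat => /eqP.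
have : (size (map F (iota 0 (size (enum_fset D)).+1)) <= size (enum_fset D))%N.
  apply: uniq_leq_size; first by rewrite map_inj_uniq ?iota_uniq.
  by move=> x /mapP[k _ ->]; exact: inD.
by rewrite size_map size_iota ltnn.
Qed.

Hypothesis D_irreducible : irreducible dot D.

(** Preserved Cartan integers give (w a, w b) = rho_a (a, b). By symmetry rho agrees on
    non-orthogonal roots, so it is constant by irreducibility; it is 1 because w permutes [D] and
    hence preserves the sum of all (a, a). *)
Lemma Aut_isometry u v : dot (w u) (w v) = dot u v.
Proof.
have d0 a : a \in D -> 0 < dot a a by move=> /root_neq; exact: dot_gt0.
pose rho a := dot (w a) (w a) / dot a a.
have rhoE a b : a \in D -> b \in D -> dot (w a) (w b) = rho a * dot a b.
  move=> aD bD; have := Aut_cartan aD bD; rewrite !dot_coroot /rho.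
  have := d0 _ aD; have := d0 _ (Aut_root aD).
  move: (dot (w a) (w a)) (dot (w a) (w b)) (dot a a) (dot a b) => x y z t x0 z0.
  move=> /(congr1 ( *%R ( x / 2))); rewrite (_ : x / 2 * _ = y); last by field;
    rewrite gt_eqF.
  by move=> ->; field; rewrite gt_eqF.
have [DN0 Dirr] := D_irreducible.
have [a0 a0D] : exists a0, a0 \in D by apply/fset0Pn.
have rhoC a : a \in D -> rho a = rho a0.
  move=> aD; apply: contrapT => ra; apply: Dirr.
  exists [fset b in D | rho b == rho a0], [fset b in D | rho b != rho a0]; split.
  - by apply/fset0Pn; exists a0; rewrite !inE/= a0D eqxx.
  - by apply/fset0Pn; exists a; rewrite !inE/= aD; apply/eqP.
  - by apply/fsetP => b; rewrite !inE/=; case: (b \in D) => //=; case: eqP.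
  - move=> x y; rewrite !inE/= => /andP[xD /eqP rx] /andP[yD ry].
    apply/eqP; apply: contraNT ry => xy; rewrite -rx; apply/eqP/esym.
    by apply: (mulIf xy); rewrite -rhoE// [in RHS]dotC -rhoE// dotC.
have rho1 : rho a0 = 1.
  have sE : \sum_(a <- D) dot (w a) (w a) = \sum_(a <- D) dot a a.
    transitivity (\sum_(a <- [fset w a | a in D]) dot a a).
      by rewrite big_imfset//= => x y _ _; exact: Aut_inj.
    by rewrite w_Aut.2.
  have s0 : 0 < \sum_(a <- D) dot a a.
    rewrite (bigD1_seq a0) ?fset_uniq//= ltr_pwDl ?d0// big_seq_cond sumr_ge0//.
    by move=> a /andP[aD _]; rewrite ltW ?d0.
  apply: (mulIf (lt0r_neq0 s0));
    rewrite mul1r -[RHS]sE big_distrr/= big_seq [RHS]big_seq.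
  by apply: eq_bigr => a aD; rewrite rhoE// rhoC.
move: u; apply: root_span_ind => [|c u1 u2 e1 e2|a aD].
- by rewrite linear0 !dot0l.
- by rewrite linearP/= !dotDl !dotZl e1 e2.
move: v; apply: root_span_ind => [|c u1 u2 e1 e2|b bD].
- by rewrite linear0 dotC dot0l dotC dot0l.
- by rewrite linearP/= !dotDr !dotZr e1 e2.
- by rewrite rhoE// rhoC// rho1 mul1r.
Qed.

Lemma Aut_coroot a : coroot dot (w a) = w (coroot dot a).
Proof. by rewrite /coroot Aut_isometry linearZ. Qed.

End Automorphism.
End Root.
End RootFacts.

(** * Positive roots and integrality of coroots *)

Section PositiveRoots.
Variables (R : realType) (V : vectType R) (dot : {dot V for idfun}).
Variables (D : {fset V}) (r : nat) (Psi : r.-tuple V) (lam : 'I_r -> V).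
Hypotheses (D_root : root_system dot D) (Psi_fund : fundamental_system D Psi).

Local Notation alpha := (tnth Psi).
Local Notation pos := (pos_roots D Psi).

Lemma in_pos_roots a : (a \in pos) = (a \in D) && [forall i, 0 <= coord Psi i a].
Proof. by rewrite /pos_roots !inE. Qed.

Lemma pos_root a : a \in pos -> a \in D.
Proof. by rewrite in_pos_roots => /andP[]. Qed.

Lemma root_pos_or_neg a : a \in D -> (a \in pos) || (- a \in pos).
Proof.
move=> aD; rewrite !in_pos_roots aD (root_opp D_root)//=.
have [h|h] := fundamental_sign Psi_fund aD; apply/orP; [left|right]; apply/forallP => i.
  exact: natr_ge0.
by rewrite linearN/= natr_ge0 ?h.
Qed.

Lemma expand_basis v : v = \sum_i coord Psi i v *: alpha i.
Proof.
have [/eqP Pspan _] := andP (fundamental_basis Psi_fund).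
rewrite {1}(coord_span (_ : v \in <<Psi>>%VS)) ?Pspan ?memvf//.
by apply: eq_bigr => i _; rewrite (tnth_nth 0).
Qed.

Lemma pos_root_opp a : a \in pos -> - a \notin pos.
Proof.
rewrite !in_pos_roots => /andP[aD /forallP a0]; rewrite negb_and; apply/orP; right.
apply/negP => /forallP a0'; have := root_neq D_root aD;
  rewrite (expand_basis a) big1 ?eqxx// => i _.
suff -> : coord Psi i a = 0 by rewrite scale0r.
by apply/eqP; rewrite eq_le a0 andbT -oppr_ge0 -linearN a0'.
Qed.

Lemma neg_root a : a \in D -> (- a \in pos) = (a \notin pos).
Proof.
move=> aD; apply/idP/idP => [na|].
  by have := pos_root_opp na; rewrite opprK.
by have := root_pos_or_neg aD; case: (a \in pos).
Qed.

Lemma simple_root i : alpha i \in D.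
Proof. by apply: (fundamental_root Psi_fund); exact: mem_tnth. Qed.

Lemma coord_alpha i j : coord Psi i (alpha j) = (i == j)%:R.
Proof.
by rewrite (tnth_nth 0) coord_free ?(basis_free (fundamental_basis Psi_fund))// eq_sym.
Qed.

Lemma simple_pos i : alpha i \in pos.
Proof.
by rewrite in_pos_roots simple_root; apply/forallP => j; rewrite coord_alpha ler0n.
Qed.

Lemma uniq_simple : uniq Psi.
Proof. exact: free_uniq (basis_free (fundamental_basis Psi_fund)). Qed.

Definition abs_root a : V := if a \in pos then a else - a.

Lemma abs_root_pos a : a \in D -> abs_root a \in pos.
Proof. by move=> aD; rewrite /abs_root; case: ifP => // /negbT; rewrite neg_root. Qed.

(** Such a map permutes the classes modulo sign, each of which has exactly one positive member. *)
Lemma perm_abs_root (f : V -> V) : injective f -> {morph f : x / - x} ->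
  {in D, forall a, f a \in D} ->
  perm_eq [seq abs_root (f a) | a <- pos] (enum_fset pos).
Proof.
move=> finj fN fD.
have uf : uniq [seq abs_root (f a) | a <- pos].
  rewrite map_inj_in_uniq ?fset_uniq// => a b ap bp.
  have := pos_root_opp bp; have := pos_root_opp ap.
  rewrite /abs_root; case: ifP => _; case: ifP => _ nap nbp.
  - exact: finj.
  - by rewrite -fN => /finj ab; rewrite -ab ap in nbp.
  - by rewrite -fN => /finj ab; rewrite ab bp in nap.
  - by move=> /oppr_inj /finj.
apply: uniq_perm => //; first exact: fset_uniq.
apply: (uniq_min_size _ _ _).2 => //.
  by move=> _ /mapP[a ap ->]; apply: abs_root_pos; apply: fD; exact: pos_root.
by rewrite size_map.
Qed.

Lemma big_abs_root (T : Type) (idx : T) (op : Monoid.com_law idx) (f : V ->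
  V) (F : V -> T) :
  injective f -> {morph f : x / - x} -> {in D, forall a, f a \in D} ->
  \big[op/idx]_(a <- pos) F (abs_root (f a)) = \big[op/idx]_(a <- pos) F a.
Proof.
move=> finj fN fD; rewrite -(big_map (fun a => abs_root (f a)) xpredT F).
by apply: perm_big; exact: perm_abs_root.
Qed.

Hypothesis D_reduced : reduced D.
Hypothesis lam_weights : fundamental_weights dot Psi lam.

Lemma reflection_coroot i b :
  dot (coroot dot (reflection dot (alpha i) b)) (lam i) =
  dot (coroot dot b) (lam i) - dot (coroot dot b) (alpha i).
Proof.
rewrite coroot_reflection ?(root_neq D_root (simple_root i))// reflectionE dotBl.
rewrite (dotZl dot (dot (alpha i) _)).
by rewrite lam_weights eqxx mulr1 (dotC dot (alpha i)).
Qed.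

Lemma reflection_coroot_int i b : b \in D ->
  (forall j, dot (coroot dot (reflection dot (alpha i) b)) (lam j) \is a Num.int) ->
  forall j, dot (coroot dot b) (lam j) \is a Num.int.
Proof.
move=> bD intb j; have := intb j.
rewrite coroot_reflection ?(root_neq D_root (simple_root i))// reflectionE dotBl.
rewrite (dotZl dot (dot (alpha i) _)).
rewrite lam_weights (dotC dot (alpha i)) => H; rewrite -[X in X \is a _](subrK
  (dot (coroot dot b) (alpha i) * (i == j)%:R)).
apply: rpredD => //; apply: rpredM; last exact: rpred_nat.
by apply: (root_integral D_root) => //; exact: simple_root.
Qed.

(** Induction on the height. Since (a, a) > 0, some alpha_i with positive coefficient in a has
    (alpha_i, a) > 0; reflecting in it lowers the height by at least 1, and integrality carries
    back. *)
Lemma pos_coroot_int a : a \in pos ->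
  forall j, dot (coroot dot a) (lam j) \is a Num.int.
Proof.
pose height v := \sum_i coord Psi i v.
have [n] : exists n : nat, height a < n%:R.
  by exists (Num.truncn (height a)).+1; rewrite truncnS_gt.
elim: n a => [|n IH] a an ap.
  move: an; rewrite ltNge => /negP[]; apply: sumr_ge0 => i _.
  by move: ap; rewrite in_pos_roots => /andP[_ /forallP].
have aD := pos_root ap; have a0 := dot_gt0 dot (root_neq D_root aD).
have coord_ge0 i : 0 <= coord Psi i a.
  by move: ap; rewrite in_pos_roots => /andP[_ /forallP].
have [i ci ai] : exists2 i, 0 < coord Psi i a & 0 < dot (alpha i) a.
  apply: contrapT => H; move: a0; rewrite {1}(expand_basis a) dot_suml.
  rewrite ltNge => /negP; apply; apply: sumr_le0 => i _; rewrite dotZl.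
  have := coord_ge0 i; rewrite le_eqVlt => /predU1P[<-|ci]; first by rewrite mul0r.
  rewrite pmulr_rle0// leNgt; apply/negP => ai; apply: H; by exists i.
pose m := dot (coroot dot (alpha i)) a.
have m0 : 0 < m.
  by rewrite /m dot_coroot divr_gt0 ?mulr_gt0//; apply: dot_gt0;
    exact: (root_neq D_root (simple_root i)).
have mint : m \is a Num.int by apply: (root_integral D_root) => //; exact: simple_root.
have m1 : 1 <= m.
  by move/intrP: mint m0 => [k ->]; rewrite ltr0z -[1]/(1%:~R) ler_int gtz0_ge1.
(* With no other positive coefficient, [a] is a multiple of [alpha i], hence equal to it as [D] is
   reduced. Otherwise the coefficient at [j], unchanged by the reflection, keeps the root
   positive. *)
have [j /andP[ji cj]|all0] := pickP (fun j => (j != i) && (0 < coord Psi j a));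
  last first.
  have ai1 : a = coord Psi i a *: alpha i.
    rewrite {1}(expand_basis a) (bigD1 i)//= big1 ?addr0// => j ji.
    have := all0 j; rewrite ji/= => /negbT; rewrite -leNgt => cj.
    by rewrite (_ : coord Psi j a = 0) ?scale0r//; apply/eqP;
      rewrite eq_le cj coord_ge0.
  have c1 : coord Psi i a = 1.
    have [] := @D_reduced (alpha i) (coord Psi i a) (simple_root i);
      rewrite -?ai1// => E.
    by move: ci; rewrite E ltr0N1.
  by move=> j; rewrite ai1 c1 scale1r lam_weights; case: eqP.
pose b := reflection dot (alpha i) a.
have bD : b \in D by apply: (root_reflection D_root) => //; exact: simple_root.
have cb k : coord Psi k b = coord Psi k a - m * (k == i)%:R.
  by rewrite /b /reflection linearB linearZ/= coord_alpha.
have bp : b \in pos.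
  rewrite in_pos_roots bD; have [h|h] := fundamental_sign Psi_fund bD.
    by apply/forallP => k; exact: natr_ge0.
  have := natr_ge0 (h j); rewrite cb (negbTE ji) mulr0 subr0 oppr_ge0 leNgt cj//.
have := @reflection_coroot_int i a aD; apply.
apply: IH => //; rewrite /height.
under eq_bigr do rewrite cb.
rewrite sumrB -mulr_sumr (_ : \sum_k (k == i)%:R = 1); last first.
  by rewrite (bigD1 i)//= eqxx big1 ?addr0// => k /negbTE ->.
by move: an m1; rewrite /height mulr1 -natr1; lra.
Qed.

Lemma coroot_int a j : a \in D -> dot (coroot dot a) (lam j) \is a Num.int.
Proof.
move=> aD; have /orP[ap|ap] := root_pos_or_neg aD; first exact: pos_coroot_int.
by rewrite -[a]opprK corootN dotNl rpredN; exact: pos_coroot_int.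
Qed.

Lemma coroot_expansion v : \sum_i dot v (lam i) *: coroot dot (alpha i) = v.
Proof.
have -> : v = \sum_j (coord Psi j v * dot (alpha j) (alpha j) / 2) *: coroot dot
  (alpha j).
  rewrite {1}(expand_basis v); apply: eq_bigr => j _.
  have a0 := dot_gt0 dot (root_neq D_root (simple_root j)).
  rewrite /coroot scalerA; congr (_ *: _); field; exact: lt0r_neq0.
apply: eq_bigr => i _; congr (_ *: _); rewrite dot_suml (bigD1 i)//= big1.
  by rewrite addr0 dotZl lam_weights eqxx mulr1.
by move=> j ji; rewrite dotZl lam_weights (negbTE ji) mulr0.
Qed.

Hypotheses (D_irreducible : irreducible dot D) (D_notA1 : ~ type_A1 D).

(** This is what makes the coordinate of alpha_i vary on the cosets. It comes from a root b !=
    alpha_i, -alpha_i not orthogonal to alpha_i, or from the reflection of b. *)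
Lemma coroot_coef_neq0 i : exists c, [/\ c \in pos, c \notin (Psi : seq V) &
  dot (coroot dot c) (lam i) != 0].
Proof.
have [DN0 Dirr] := D_irreducible.
have aD := simple_root i; have a0 := root_neq D_root aD.
have [b [bD ba bNa dba]] : exists b, [/\ b \in D, b != alpha i, b != -
  alpha i & dot b (alpha i) != 0].
  (* Otherwise [D] splits orthogonally into the pair of [alpha i] and the rest; an empty rest means
     type A_1, a nonempty one reducibility. *)
  apply: contrapT => H.
  have orth b : b \in D -> b != alpha i -> b != - alpha i -> dot b (alpha i) = 0.
    by move=> bD b1 b2; apply/eqP/negPn/negP => b3; apply: H; exists b.
  pose D2 := [fset b in D | (b != alpha i) && (b != - alpha i)].
  have DE : D = [fset alpha i; - alpha i] `|` D2.
    apply/fsetP => b; rewrite !inE/=.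
    have [->|b1] := eqVneq b (alpha i); first by rewrite aD.
    have [->|b2] := eqVneq b (- alpha i); first by rewrite (root_opp D_root aD) orbT.
    by rewrite andbT.
  have [D20|D2N0] := eqVneq D2 fset0.
    by apply: D_notA1; exists (alpha i); split=> //; rewrite {1}DE D20 fsetU0.
  apply: Dirr; exists [fset alpha i; - alpha i], D2; split=> //.
    by apply/fset0Pn; exists (alpha i); rewrite !inE eqxx.
  move=> x b; rewrite !inE/= => xa /andP[bD /andP[b1 b2]].
  by have /orP[/eqP->|/eqP->] := xa; rewrite ?dotNl dotC orth ?oppr0.
have key c : c \in D -> c != alpha i -> c != - alpha i ->
    dot (coroot dot c) (lam i) != 0 -> exists c, [/\ c \in pos, c \notin (Psi : seq V) &
    dot (coroot dot c) (lam i) != 0].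
  move=> cD c1 c2 c3; exists (abs_root c); split; first exact: abs_root_pos.
    apply/negP => /tnthP[j cj]; have jc : c = alpha j \/ c = - alpha j.
      by move: cj; rewrite /abs_root; case: ifP => _ <-; [left|right; rewrite opprK].
    have ij : j != i.
      by apply/eqP => ji; move: jc c1 c2; rewrite ji => -[] ->; rewrite eqxx.
    by case: jc c3 => ->; rewrite ?corootN ?dotNl lam_weights (negbTE ij) ?oppr0 eqxx.
  by rewrite /abs_root; case: ifP => // _; rewrite corootN dotNl oppr_eq0.
(* If the coefficient for b vanishes, that for its reflection is -(b^vee, alpha_i), which is
   nonzero. *)
have [bl|] := eqVneq (dot (coroot dot b) (lam i)) 0; last exact: key.
apply: (key (reflection dot (alpha i) b)).
- exact: (root_reflection D_root).
- apply: contra bNa => /eqP E.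
  by rewrite -[b](reflectionK dot a0) E reflection_self.
- apply: contra ba => /eqP E.
  by rewrite -[b](reflectionK dot a0) E -scaleN1r reflectionZ reflection_self//
    scalerN scaleN1r opprK.
- rewrite reflection_coroot bl sub0r oppr_eq0 dot_coroot mulf_neq0//.
    by rewrite mulf_neq0// pnatr_eq0.
  by rewrite invr_eq0 gt_eqF// dot_gt0// (root_neq D_root bD).
Qed.
End PositiveRoots.

(** * Symmetry of P *)

Section PeriodicBernoulli.
Variable R : realType.
Implicit Types (u : R) (n : nat).

Definition periodic_bernoulli n u : R := (bernoulli R n).[frac_part u].

(* The restriction of B_n to [0, 1] extended by periodicity outside this
   interval: unlike [periodic_bernoulli n], it has the value B_n(1) at 1. *)
Definition closed_bernoulli n u : R :=
  periodic_bernoulli n u +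
  ((bernoulli R n).[1] - periodic_bernoulli n 1) * \1_[set 1%R] u.

Lemma frac_part_itv u : 0 <= frac_part u < 1.
Proof.
have /andP[A B] := floor_itv u; rewrite /frac_part subr_ge0 A/=.
by rewrite ltrBlDr addrC -[X in _ + X]/(1%:~R) -intrD.
Qed.

Lemma frac_partD u (k : int) : frac_part (u + k%:~R) = frac_part u.
Proof. by rewrite /frac_part floorDrz ?intr_int// intrKfloor intrD opprD addrACA
  subrr addr0. Qed.

Lemma frac_part_id u : 0 <= u < 1 -> frac_part u = u.
Proof. by move=> u01; rewrite /frac_part (@floor_def _ u 0) ?add0r// subr0. Qed.

Lemma frac_partN u : u \isn't a Num.int -> frac_part (- u) = 1 - frac_part u.
Proof.
move=> uZ; have /andP[f0 f1] := frac_part_itv u.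
have {}f0 : 0 < frac_part u.
  rewrite lt_def f0 andbT; apply: contra uZ => /eqP fu.
  by rewrite -(subrK (Num.floor u)%:~R u) -/(frac_part u) fu add0r intr_int.
rewrite -[RHS]frac_part_id; last by rewrite subr_ge0 ltW//= ltrBlDr ltrDl.
rewrite -(frac_partD (- u) (Num.floor u + 1)) intrD; congr frac_part.
by rewrite /frac_part; ring.
Qed.

Lemma periodic_bernoulliD n u (k : int) :
  periodic_bernoulli n (u + k%:~R) = periodic_bernoulli n u.
Proof. by rewrite /periodic_bernoulli frac_partD. Qed.

Lemma periodic_bernoulliN n u : u \isn't a Num.int ->
  periodic_bernoulli n (- u) = (-1) ^+ n * periodic_bernoulli n u.
Proof. by move=> uZ; rewrite /periodic_bernoulli frac_partN// bernoulli_reflection. Qed.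

Lemma closed_bernoulliE n u : 0 <= u <= 1 -> closed_bernoulli n u = (bernoulli R n).[u].
Proof.
move=> /andP[u0]; rewrite /closed_bernoulli indicE le_eqVlt => /predU1P[->|u1].
  by rewrite mem_set// mulr1 addrC subrK.
rewrite memNset ?mulr0 ?addr0 /periodic_bernoulli ?frac_part_id ?u0// => u1'.
by move: u1; rewrite u1' ltxx.
Qed.

Lemma closed_bernoulli_periodic n u : u \isn't a Num.int ->
  closed_bernoulli n u = periodic_bernoulli n u.
Proof.
move=> uZ; rewrite /closed_bernoulli indicE memNset ?mulr0 ?addr0// => u1.
by move: uZ; rewrite u1 rpred1.
Qed.

Definition bounded_measurable1 (f : R -> R) : Prop :=
  (exists M : R, forall u, `|f u| <= M) /\ measurable_fun setT f.

Lemma measurable_frac_part : measurable_fun setT (@frac_part R).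
Proof.
apply: measurable_funB => //; apply: nondecreasing_measurable => // x y xy.
by rewrite ler_int; exact: le_floor.
Qed.

Lemma bounded_measurable_periodic_bernoulli n : bounded_measurable1
  (periodic_bernoulli n).
Proof.
split; last first.
  apply: (@measurableT_comp _ _ _ _ _ _ (horner (bernoulli R n))).
    exact: measurable_poly.
  exact: measurable_frac_part.
exists (\sum_(i < size (bernoulli R n)) `|(bernoulli R n)`_i|) => u.
rewrite /periodic_bernoulli horner_coef (le_trans (ler_norm_sum _ _ _))//.
apply: ler_sum => i _; have /andP[f0 f1] := frac_part_itv u.
by rewrite normrM ler_piMr// normrX ger0_norm// exprn_ile1// ltW.
Qed.

Lemma bounded_measurable_closed_bernoulli n : bounded_measurable1 (closed_bernoulli n).
Proof.
have [[M bM] mb] := bounded_measurable_periodic_bernoulli n; split.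
  exists (M + `|(bernoulli R n).[1] - periodic_bernoulli n 1|) => u.
  rewrite (le_trans (ler_normD _ _))// lerD// normrM ler_piMr// indicE.
  by case: (_ \in _); rewrite ?normr1 ?normr0.
apply: measurable_funD => //; apply: measurable_funM => //.
Qed.

Lemma bounded_measurable_scale (c : R) f : bounded_measurable1 f ->
  bounded_measurable1 (fun u => c * f (- u)).
Proof.
move=> [[M fM] mf]; split.
  by exists (`|c| * M) => u; rewrite normrM ler_wpM2l.
by apply: measurable_funM => //; apply: (measurableT_comp mf); exact: oppr_measurable.
Qed.

End PeriodicBernoulli.

Section AffineProducts.
Variables (R : realType) (I : eqType) (s : seq I) (B : I -> I -> int) (v : I -> R).

Let q a (x : I -> R) : R := v a + int_linear s B x a.

Let bm_mul (G1 G2 : (I -> R) -> R) : bounded_measurable G1 -> bounded_measurable G2 ->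
  bounded_measurable (fun x => G1 x * G2 x).
Proof.
move=> [[M1 b1] m1] [[M2 b2] m2]; split.
  by exists (M1 * M2) => x; rewrite normrM ler_pM.
by move=> d T X mX; apply: measurable_funM; [exact: m1|exact: m2].
Qed.

Lemma bounded_measurable_coord_prod (t : seq I) (f : I -> R -> R) :
  (forall a, bounded_measurable1 (f a)) ->
  bounded_measurable (fun x => \prod_(a <- t) f a (x a)).
Proof.
move=> nf; elim: t => [|a t IH].
  rewrite (_ : (fun _ => _) = fun=> 1); last by apply/funext => x; rewrite big_nil.
  by split; [exists 1 => x; rewrite normr1|move=> *; exact: measurable_cst].
rewrite (_ : (fun _ => _) = fun x => f a (x a) * \prod_(a <- t) f a (x a)).
  apply: bm_mul => //; have [[M fM] mf] := nf a; split; first by exists M => x;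
    exact: fM.
  by move=> d T X mX; apply: measurableT_comp.
by apply/funext => x; rewrite big_cons.
Qed.

Lemma bounded_measurable_affine_prod (t : seq I) (f : I -> R -> R) :
  (forall a, bounded_measurable1 (f a)) ->
  bounded_measurable (fun x => \prod_(a <- t) f a (v a + int_linear s B x a)).
Proof.
move=> /(bounded_measurable_coord_prod t).
move=> /(@bounded_measurable_comp R I I _ (fun x a => q a x)); apply.
move=> d T X mX a; apply: measurable_funD => //.
by apply: measurable_sum => b; apply: measurable_funM.
Qed.

Let bm_factor f a : bounded_measurable1 f -> bounded_measurable (fun x => f (q a x)).
Proof.
move=> nf; have := @bounded_measurable_affine_prod [:: a] (fun=> f) (fun=> nf).
by congr bounded_measurable; apply/funext => x; rewrite big_seq1.
Qed.

(** Factors are exchanged one at a time: factor a changes only where its argument is an integer,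
    which is negligible since row a of [B] is nonzero. *)
Lemma cube_integral_replace (f g : I -> R -> R) x :
  uniq s ->
  (forall a, bounded_measurable1 (f a)) -> (forall a, bounded_measurable1 (g a)) ->
  (forall a, a \in s -> exists2 b, b \in s & B a b != 0) ->
  (forall a u, u \isn't a Num.int -> f a u = g a u) ->
  cube_integral s (fun x => \prod_(a <- s) f a (v a + int_linear s B x a)) x =
  cube_integral s (fun x => \prod_(a <- s) g a (v a + int_linear s B x a)) x.
Proof.
move=> us nf ng BN0 fg.
(* [E] collects the factors already exchanged. *)
suff H t E : {subset t <= s} -> bounded_measurable E ->
    cube_integral s (fun x => E x * \prod_(a <- t) f a (v a + int_linear s B x a)) x =
    cube_integral s (fun x => E x * \prod_(a <- t) g a (v a + int_linear s B x a)) x.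
  have n1 : bounded_measurable (fun _ : I -> R => 1 : R).
    by split; [exists 1 => y; rewrite normr1|move=> *; exact: measurable_cst].
  have := H s _ (fun a => id) n1.
  rewrite (_ : (fun _ => 1 * _) = (fun x =>
    \prod_(a <- s) f a (v a + int_linear s B x a))); last first.
    by apply/funext => y; rewrite mul1r.
  move=> ->; congr cube_integral; by apply/funext => y; rewrite mul1r.
elim: t E => [|a t IH] E ts nE; first by under eq_fun do rewrite big_nil;
  under [in RHS]eq_fun do rewrite big_nil.
have as' : a \in s by apply: ts; rewrite mem_head.
have ts' : {subset t <= s} by move=> c ct; apply: ts; rewrite inE ct orbT.
transitivity (cube_integral s (fun x => E x * f a (q a x) *
    \prod_(a <- t) g a (v a + int_linear s B x a)) x).
  rewrite -IH//; last by apply: bm_mul => //; exact: bm_factor.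
  by congr cube_integral; apply/funext => y; rewrite big_cons mulrA.
have [b bs Bab] := BN0 a as'.
apply: (@eq_cube_integral_off_integers _ _ s b _ _ (q a) (B a b)%:~R) => //.
- by do 2?[apply: bm_mul => //];
  [exact: bm_factor|exact: bounded_measurable_affine_prod].
- apply: bm_mul => //; exact: (@bounded_measurable_affine_prod (a :: t)).
- by rewrite intr_eq0.
- move=> y u; rewrite /q -addrA; congr (_ + _).
  rewrite /int_linear (bigD1_seq b)//= eqxx [in RHS](bigD1_seq b)//= eqxx mulr0
    add0r addrC.
  congr (_ + _); apply: eq_bigr => c /negbTE cb; rewrite cb//.
- by move=> y _ qZ; rewrite big_cons mulrA -fg.
Qed.
End AffineProducts.

(** * P as an integral over a coset *)

Section Symmetry.
Variables (R : realType) (V : vectType R) (dot : {dot V for idfun}).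
Variables (D : {fset V}) (r : nat) (Psi : r.-tuple V) (lam : 'I_r -> V).
Hypotheses (D_root : root_system dot D) (D_reduced : reduced D).
Hypotheses (D_irreducible : irreducible dot D) (D_notA1 : ~ type_A1 D).
Hypotheses (Psi_fund : fundamental_system D Psi).
Hypotheses (lam_weights : fundamental_weights dot Psi lam).

Local Notation alpha := (tnth Psi).
Local Notation pos := (pos_roots D Psi).
Local Notation abs := (abs_root D Psi).

Lemma at_root_pos (A : nmodType) (k : root_vector D Psi A) a (ap : a \in pos) :
  at_root k a = k [` ap].
Proof. by rewrite /at_root insubT. Qed.

Lemma at_root_val (A : nmodType) (k : root_vector D Psi A) (a : pos) :
  at_root k (val a) = k a.
Proof. by rewrite /at_root valK. Qed.

Lemma at_root_opp (A : nmodType) (k : root_vector D Psi A) a : a \in D ->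
  at_root k (- a) = at_root k a.
Proof.
move=> aD; have nap := neg_root D_root Psi_fund aD; rewrite /at_root opprK.
have [ap|ap] := boolP (a \in pos).
  have -> : (insub (- a) : option pos) = None by apply: insubN; rewrite nap ap.
  by rewrite insubT.
have -> : (insub a : option pos) = None by apply: insubN.
by rewrite insubT// nap.
Qed.

Lemma at_root_abs (A : nmodType) (k : root_vector D Psi A) a : a \in D ->
  at_root k (abs a) = at_root k a.
Proof. by move=> aD; rewrite /abs_root; case: ifP => // _; exact: at_root_opp. Qed.

(** Since (-a)^vee = - a^vee, coordinates are read as odd functions on [D]; automorphisms then act
    by composition, signs included. *)
Definition odd_extension (x : V ->
  R) (a : V) : R := if a \in pos then x a else - x (- a).

Lemma odd_extension_pos x a : a \in pos -> odd_extension x a = x a.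
Proof. by rewrite /odd_extension => ->. Qed.

Lemma odd_extensionN x a : a \in D -> odd_extension x (- a) = - odd_extension x a.
Proof.
move=> aD; rewrite /odd_extension (neg_root D_root Psi_fund aD).
by case: (a \in pos); rewrite ?opprK.
Qed.

Lemma eq_odd_extension x y : {in pos, x =1 y} ->
  {in D, odd_extension x =1 odd_extension y}.
Proof.
move=> xy a aD; rewrite /odd_extension; case: ifP => [/xy//|/negbT nap].
by rewrite xy// (neg_root D_root Psi_fund).
Qed.

(* The x_alpha-coordinates of a point are mapped to sum_alpha x_alpha alpha^vee,
   [simple_section] is a section of this map and [kernel_proj] the
   corresponding projection onto its kernel. *)
Definition coroot_sum (x : V -> R) : V := \sum_(a <- pos) x a *: coroot dot a.

Definition simple_section (v : V) (a : V) : R :=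
  \sum_i (a == alpha i)%:R * dot v (lam i).

Definition kernel_proj (a b : V) : int :=
  Num.floor ((a == b)%:R - simple_section (coroot dot b) a).

Lemma alpha_inj : injective alpha.
Proof. by apply/tuple_uniqP; exact: uniq_simple Psi_fund. Qed.

Lemma simple_section_alpha v i : simple_section v (alpha i) = dot v (lam i).
Proof.
rewrite /simple_section (bigD1 i)//= eqxx mul1r big1 ?addr0// => j ji.
by rewrite (inj_eq alpha_inj) eq_sym (negbTE ji) mul0r.
Qed.

Lemma simple_section_nonsimple v a : a \notin (Psi : seq V) -> simple_section v a = 0.
Proof.
move=> aP; rewrite /simple_section big1// => i _; case: eqP => [ai|_];
  last by rewrite mul0r.
by move: aP; rewrite ai mem_tnth.
Qed.

Lemma simple_sectionZ c v a : simple_section (c *: v) a = c * simple_section v a.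
Proof.
by rewrite /simple_section big_distrr/=; apply: eq_bigr => i _;
  rewrite dotZl mulrCA.
Qed.

Lemma simple_section_sum (s : seq V) (F : V -> V) a :
  simple_section (\sum_(b <- s) F b) a = \sum_(b <- s) simple_section (F b) a.
Proof.
rewrite /simple_section exchange_big/=; apply: eq_bigr => i _.
by rewrite dot_suml big_distrr.
Qed.

Lemma simple_section0 a : simple_section 0 a = 0.
Proof. by rewrite -(scale0r 0) simple_sectionZ mul0r. Qed.

(** Integrality of the coroot coefficients makes the floor in [kernel_proj] a mere change of
    type. *)
Lemma kernel_projE a b : b \in D ->
  (kernel_proj a b)%:~R = (a == b)%:R - simple_section (coroot dot b) a :> R.
Proof.
move=> bD; apply: floorK; apply: rpredB; first exact: rpred_nat.
apply: rpred_sum => i _; apply: rpredM; first exact: rpred_nat.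
exact: (coroot_int D_root Psi_fund D_reduced lam_weights).
Qed.

Lemma int_linear_kernel_proj x a : a \in pos ->
  int_linear pos kernel_proj x a = x a - simple_section (coroot_sum x) a.
Proof.
move=> ap; rewrite /int_linear /coroot_sum simple_section_sum.
transitivity (\sum_(b <- pos) ((a == b)%:R * x b -
  simple_section (x b *: coroot dot b) a)).
  rewrite !big_seq; apply: eq_bigr => b bp.
  by rewrite kernel_projE ?(pos_root bp)// mulrBl (simple_sectionZ (x b)) [x b *
    _]mulrC.
rewrite sumrB; congr (_ - _); rewrite (bigD1_seq a) ?fset_uniq//= eqxx mul1r.
by rewrite big1 ?addr0// => b /negbTE ba; rewrite eq_sym ba mul0r.
Qed.

Lemma coroot_sumB x y : coroot_sum (fun a => x a - y a) = coroot_sum x - coroot_sum y.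
Proof. by rewrite /coroot_sum -sumrB; apply: eq_bigr => a _; rewrite scalerBl. Qed.

Lemma eq_coroot_sum x y : {in pos, x =1 y} -> coroot_sum x = coroot_sum y.
Proof.
by move=> xy; rewrite /coroot_sum !big_seq; apply: eq_bigr => a ap;
  rewrite xy.
Qed.

Lemma simple_notin_nonsimple i : alpha i \notin nonsimple_pos_roots D Psi.
Proof.
apply/negP; rewrite /nonsimple_pos_roots in_fset => /andP[_ /negP]; apply.
exact: mem_tnth.
Qed.

Lemma perm_pos_simple : perm_eq pos (nonsimple_pos_roots D Psi ++ Psi).
Proof.
apply: uniq_perm; first exact: fset_uniq.
  rewrite cat_uniq fset_uniq (uniq_simple Psi_fund)/= andbT.
  by apply/hasPn => a aP; rewrite !inE/= aP andbF.
move=> a; rewrite mem_cat !inE/=.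
case: (boolP (a \in (Psi : seq V))) => [/tnthP[i ->]|_]; last by rewrite andbT orbF.
by rewrite orbT; have := simple_pos Psi_fund i; rewrite in_pos_roots.
Qed.

Lemma big_pos_roots (T : Type) (idx : T) (op : Monoid.com_law idx) (F : V -> T) :
  \big[op/idx]_(a <- pos) F a =
  op (\big[op/idx]_(a <- nonsimple_pos_roots D Psi) F a) (\big[op/idx]_i F (alpha i)).
Proof. by rewrite (perm_big _ perm_pos_simple) big_cat/= [X in op _ X]big_tuple. Qed.

Lemma coroot_sum_section v : coroot_sum (simple_section v) = v.
Proof.
rewrite /coroot_sum big_pos_roots/= big_seq big1 ?add0r.
  rewrite -[RHS](coroot_expansion D_root Psi_fund lam_weights).
  by apply: eq_bigr => i _; rewrite simple_section_alpha.
by move=> a; rewrite !inE/= => /andP[_ aP]; rewrite simple_section_nonsimple// scale0r.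
Qed.

Lemma coroot_sum_kernel_proj x : coroot_sum (int_linear pos kernel_proj x) = 0.
Proof.
rewrite (eq_coroot_sum (int_linear_kernel_proj x)) coroot_sumB.
by rewrite coroot_sum_section subrr.
Qed.

(** No coordinate is constant on the cosets: for a non-simple root the diagonal entry is 1, for a
    simple one [coroot_coef_neq0] gives the column. *)
Lemma kernel_proj_neq0 a : a \in pos -> exists2 b, b \in pos & kernel_proj a b != 0.
Proof.
move=> ap; have [/tnthP[i ->]|aP] := boolP (a \in (Psi : seq V)).
  have [c [cp cP lc]] := coroot_coef_neq0 D_root Psi_fund lam_weights D_irreducible
    D_notA1 i.
  exists c => //;
    rewrite -(intr_eq0 R) kernel_projE ?(pos_root cp)// simple_section_alpha.
  rewrite (_ : (alpha i == c) = false) ?sub0r ?oppr_eq0//.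
  by apply: contraNF cP => /eqP <-; exact: mem_tnth.
exists a => //; rewrite -(intr_eq0 R) kernel_projE ?(pos_root ap)//.
by rewrite simple_section_nonsimple// eqxx subr0 oner_eq0.
Qed.

(** Integrating over the simple coordinates as well changes nothing, and gives the coset and its
    transport by an automorphism the same parameter space. *)
Lemma P_cube_integral (k : root_vector D Psi nat) y :
  P dot lam k y = cube_integral pos (fun x => \prod_(a <- pos)
    periodic_bernoulli (at_root k a) (simple_section y a +
      int_linear pos kernel_proj x a))
    (fun=> 0).
Proof.
(* At non-simple roots [P] has B_k(x_a) without fractional part, hence the variant that is correct
   at x_a = 1. *)
pose f a : R -> R := if a \in (Psi : seq V) then periodic_bernoulli (at_root k a)
  else closed_bernoulli (at_root k a).
have nf a : bounded_measurable1 (f a).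
  rewrite /f; case: ifP => _; [exact: bounded_measurable_periodic_bernoulli|].
  exact: bounded_measurable_closed_bernoulli.
pose G x := \prod_(a <- pos) f a (simple_section y a + int_linear pos kernel_proj x a).
have nG : bounded_measurable G by exact: bounded_measurable_affine_prod.
transitivity (cube_integral (nonsimple_pos_roots D Psi) G (fun=> 0)).
  rewrite /P unit_cube_integralE ?fset_uniq//; apply: eq_cube_integral => x x01 x0.
  rewrite /G [RHS]big_pos_roots/=; congr (_ * _).
    rewrite big_seq [RHS]big_seq; apply: eq_bigr => a ans.
    have [ap aP] : a \in pos /\ a \notin (Psi : seq V).
      by move: ans; rewrite /nonsimple_pos_roots inE/= => /andP.
    rewrite int_linear_kernel_proj// !simple_section_nonsimple// add0r subr0.
    by rewrite /f (negbTE aP) closed_bernoulliE// x01.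
  apply: eq_bigr => i _; rewrite int_linear_kernel_proj ?(simple_pos Psi_fund)//.
  rewrite !simple_section_alpha /f mem_tnth /periodic_bernoulli.
  congr (_.[frac_part (_ + _)]); rewrite x0 ?sub0r; last first.
    exact: simple_notin_nonsimple.
  rewrite /coroot_sum dot_suml big_pos_roots/= [X in - (_ + X)]big1 ?addr0.
    by congr (- _); apply: eq_bigr => a _; rewrite (dotZl dot (x a)).
  move=> j _; rewrite x0 ?scale0r ?dot0l//.
  exact: simple_notin_nonsimple.
transitivity (cube_integral pos G (fun=> 0)).
  rewrite (cube_integral_perm nG perm_pos_simple) cube_integral_cat.
  congr cube_integral; apply/funext => x; rewrite cube_integral_indep// => y1 y2 y12.
  apply: eq_bigr => a _; congr (f a (_ + _)); rewrite /int_linear !big_seq.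
  apply: eq_bigr => b bp; have [bP|/y12->//] := boolP (b \in (Psi : seq V)).
  (* Columns at simple roots vanish: the section of a simple coroot is its own coordinate vector. *)
  suff -> : kernel_proj a b = 0 by rewrite !mul0r.
  rewrite /kernel_proj; have /tnthP[j ->] := bP.
  have -> : simple_section (coroot dot (alpha j)) a = (a == alpha j)%:R.
    rewrite /simple_section (bigD1 j)//= lam_weights eqxx mulr1 big1 ?addr0// => i ij.
    by rewrite lam_weights [j == i]eq_sym (negbTE ij) mulr0.
  by rewrite subrr floor0.
apply: (@cube_integral_replace _ _ _ _ _ f
  (fun a => periodic_bernoulli (at_root k a))) => //.
- exact: fset_uniq.
- by move=> a; exact: bounded_measurable_periodic_bernoulli.
- exact: kernel_proj_neq0.
- by move=> a u uZ; rewrite /f; case: ifP => // _; exact: closed_bernoulli_periodic.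
Qed.

End Symmetry.

(** * Transport of cosets by an automorphism *)

Section AutomorphismSymmetry.
Variables (R : realType) (V : vectType R) (dot : {dot V for idfun}).
Variables (D : {fset V}) (r : nat) (Psi : r.-tuple V) (lam : 'I_r -> V).
Hypotheses (D_root : root_system dot D) (D_reduced : reduced D).
Hypotheses (D_irreducible : irreducible dot D) (D_notA1 : ~ type_A1 D).
Hypotheses (Psi_fund : fundamental_system D Psi).
Hypotheses (lam_weights : fundamental_weights dot Psi lam).
Variables (w : 'End(V)) (w_Aut : Aut D w).

Local Notation pos := (pos_roots D Psi).
Local Notation abs := (abs_root D Psi).
Local Notation hat := (odd_extension D Psi).
Local Notation w' := (w^-1)%VF.

Let wD a : a \in D -> w a \in D. Proof. exact: Aut_root. Qed.
Let w'D a : a \in D -> w' a \in D. Proof. by apply: Aut_root; exact: Aut_inv. Qed.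
Let wK : cancel w w'. Proof. exact: Aut_invK w_Aut. Qed.
Let w'K : cancel w' w. Proof. exact: Aut_inv_linK w_Aut. Qed.
Let posD a : a \in pos -> a \in D. Proof. exact: pos_root. Qed.
Let negE a : a \in D ->
  (- a \in pos) = (a \notin pos). Proof. exact: (neg_root D_root Psi_fund). Qed.

(** Reindex by the positive representative of f a: x_b b^vee depends only on b up to sign, and f
    maps coroots to coroots. *)
Lemma coroot_sum_odd_extension (f g : 'End(V)) x : Aut D f -> cancel f g ->
  cancel g f ->
  coroot_sum dot D Psi (fun a => hat x (f a)) = g (coroot_sum dot D Psi x).
Proof.
move=> f_Aut fK gK; rewrite /coroot_sum linear_sum/=.
have co a : coroot dot (f a) =
  f (coroot dot a) by exact: (Aut_coroot D_root f_Aut D_irreducible).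
pose F b := hat x b *: g (coroot dot b).
transitivity (\sum_(a <- pos) F (abs (f a))).
  rewrite !big_seq; apply: eq_bigr => a ap; have faD := Aut_root f_Aut (posD ap).
  rewrite /F /abs_root; case: ifP => _; first by rewrite co fK.
  by rewrite (odd_extensionN D_root Psi_fund)// corootN linearN/= co fK scaleNr
    scalerN opprK.
transitivity (\sum_(a <- pos) F a).
  apply: (big_abs_root D_root Psi_fund).
  - exact: can_inj fK.
  - by move=> a; rewrite linearN.
  - exact: Aut_root.
by rewrite !big_seq; apply: eq_bigr => a ap; rewrite linearZ /F odd_extension_pos.
Qed.

(** The kernel projection carried over by w: row a is row w^-1 a, negated through the positive
    representative when w^-1 a is negative. *)
Definition twisted_proj (a b : V) : int :=
  if w' a \in pos then kernel_proj dot Psi lam (w' a) b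
  else - kernel_proj dot Psi lam (- w' a) b.

Lemma int_linear_twisted_proj (x : V -> R) a :
  int_linear pos twisted_proj x a =
    hat (int_linear pos (kernel_proj dot Psi lam) x) (w' a).
Proof.
rewrite /odd_extension /int_linear /twisted_proj; case: ifP => _ //.
by rewrite -sumrN; apply: eq_bigr => b _; rewrite rmorphN mulNr.
Qed.

Local Notation proj := (kernel_proj dot Psi lam).
Local Notation sec := (simple_section dot Psi lam).
Local Notation csum := (coroot_sum dot D Psi).

Let projE x a : a \in pos -> int_linear pos proj x a = x a - sec (csum x) a.
Proof. exact: int_linear_kernel_proj. Qed.

Lemma eq_kernel_proj u : csum u = 0 -> {in pos, int_linear pos proj u =1 u}.
Proof. by move=> u0 a ap; rewrite projE// u0 simple_section0 subr0. Qed.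

(** The family on the left is the w-image of the coset of w^-1 y, which is the coset of y in another
    parametrization. *)
Lemma P_twisted (k : root_vector D Psi nat) y :
  cube_integral pos (fun x => \prod_(a <- pos) periodic_bernoulli (at_root k a)
    (hat (sec (w' y)) (w' a) + int_linear pos twisted_proj x a)) (fun=> 0) =
  P dot lam k y.
Proof.
rewrite (P_cube_integral D_root)//.
apply: (@cube_integral_coset _ _ _
  (fun q => \prod_(a <- pos) periodic_bernoulli (at_root k a) (q a))).
- exact: fset_uniq.
- apply: (@bounded_measurable_coord_prod _ _ pos (fun a =>
  periodic_bernoulli (at_root k a))) => a.
  exact: bounded_measurable_periodic_bernoulli.
- by move=> q1 q2 q12; rewrite !big_seq; apply: eq_bigr => a ap; rewrite q12.
- by move=> q n; apply: eq_bigr => a _; rewrite periodic_bernoulliD.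
(* Pulled back by w, a kernel element stays in the kernel, so the projection fixes it and it serves
   as its own parameter. *)
- move=> z; pose p := int_linear pos proj z.
  exists (fun a => hat p (w a)) => a ap; rewrite int_linear_twisted_proj.
  have K : csum (fun a => hat p (w a)) = 0.
    rewrite (coroot_sum_odd_extension _ w_Aut wK w'K).
    by rewrite /p (coroot_sum_kernel_proj D_root)// linear0.
  rewrite (eq_odd_extension D_root Psi_fund (eq_kernel_proj K)) ?w'D ?posD//.
  rewrite {1}/odd_extension; case: ifP => _; rewrite ?linearN/= w'K.
    by rewrite odd_extension_pos.
  by rewrite (odd_extensionN D_root Psi_fund) ?posD// opprK odd_extension_pos.
(* The w-image of a point over w^-1 y lies over y, so it is the section of y plus its own
   projection. *)
- move=> z; pose p a := sec (w' y) a + int_linear pos proj z a.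
  have hatp a : hat (sec (w' y)) a + hat (int_linear pos proj z) a = hat p a.
    by rewrite /odd_extension /p; case: ifP => _; rewrite // opprD.
  exists (fun a => hat p (w' a)) => a ap; rewrite int_linear_twisted_proj hatp projE//.
  rewrite (coroot_sum_odd_extension _ (Aut_inv w_Aut) w'K wK).
  have -> : csum p = w' y.
    rewrite /p; transitivity (csum (sec (w' y)) + csum (int_linear pos proj z)).
      by rewrite /coroot_sum -big_split; apply: eq_bigr => b _; rewrite scalerDl.
    by rewrite (coroot_sum_section D_root)// (coroot_sum_kernel_proj D_root)// addr0.
  by rewrite w'K addrC subrK.
Qed.

Lemma in_inversion_set a :
  (a \in inversion_set D Psi w') = (a \in pos) && (w' a \notin pos).
Proof.
rewrite /inversion_set in_fsetI (Aut_invV w_Aut).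
apply: andb_id2l => ap; have aD := posD ap.
apply/imfsetP/idP => /= [[b /imfsetP[c /= cp ->] ->]|nap].
  by rewrite linearN/= linearN/= wK negE ?posD// cp.
exists (w' a); last by rewrite w'K.
by apply/imfsetP; exists (- w' a); rewrite ?opprK//= negE ?w'D.
Qed.

Definition inversion_sign (k : root_vector D Psi nat) : R :=
  \prod_(a <- pos) (if w' a \in pos then 1 else (-1) ^+ at_root k a).

Lemma inversion_signE (k : root_vector D Psi nat) :
  \prod_(a <- inversion_set D Psi w') (-1) ^- at_root k a = inversion_sign k.
Proof.
rewrite /inversion_sign;
  transitivity (\prod_(a <- pos | w' a \notin pos) (-1) ^+ at_root k a : R).
  rewrite -[RHS]big_filter.
  under eq_bigr => a _ do rewrite invr_sign.
  apply: perm_big; apply: uniq_perm; rewrite ?filter_uniq ?fset_uniq// => a.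
  by rewrite mem_filter andbC; exact: in_inversion_set.
by rewrite big_mkcond/=; apply: eq_bigr => a _; case: (w' a \in pos).
Qed.

Lemma at_root_act_k (k : root_vector D Psi nat) a : a \in pos ->
  at_root (act_k w' k) a = at_root k (w a).
Proof. by move=> ap; rewrite at_root_pos ffunE (Aut_invV w_Aut). Qed.

(** Renaming coordinates from a to w a up to sign turns the integrand over w^-1 y into the twisted
    one; each a with w a negative costs one reflection of its Bernoulli factor. *)
Lemma P_symmetry (k : root_vector D Psi nat) y :
  P dot lam (act_k w' k) (w' y) = inversion_sign k * P dot lam k y.
Proof.
rewrite (P_cube_integral D_root)// -P_twisted -cube_integralZl; last first.
  apply: (@bounded_measurable_affine_prod _ _ _ _ _ _
    (fun a => periodic_bernoulli (at_root k a))) => a.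
  exact: bounded_measurable_periodic_bernoulli.
pose f a : R -> R := periodic_bernoulli (at_root k (w a)).
(* Agrees with [f] off the integers; the negated argument is the value of the odd extension at
   -a. *)
pose g a : R -> R := if w a \in pos then f a
  else fun u => (-1) ^+ at_root k (w a) * f a (- u).
transitivity (cube_integral pos (fun x => \prod_(a <- pos)
    f a (sec (w' y) a + int_linear pos proj x a)) (fun=> 0)).
  congr cube_integral; apply/funext => x; rewrite !big_seq.
  by apply: eq_bigr => a ap; rewrite at_root_act_k.
rewrite (@cube_integral_replace _ _ _ _ _ f g)//; first last.
- move=> a u uZ; rewrite /g; case: ifP => // _; rewrite /f periodic_bernoulliN//.
  by rewrite mulrA -expr2 sqrr_sign mul1r.
- exact: kernel_proj_neq0.
- move=> a; rewrite /g; case: ifP => _; last apply: bounded_measurable_scale;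
    exact: bounded_measurable_periodic_bernoulli.
- by move=> a; exact: bounded_measurable_periodic_bernoulli.
- exact: fset_uniq.
congr cube_integral; apply/funext => x.
pose p a := sec (w' y) a + int_linear pos proj x a.
pose G a := (if w' a \in pos then 1 else (-1) ^+ at_root k a) *
  periodic_bernoulli (at_root k a) (hat p (w' a)).
transitivity (\prod_(a <- pos) G (abs (w a))).
  rewrite !big_seq; apply: eq_bigr => a ap; have aD := posD ap.
  rewrite /G (at_root_abs D_root Psi_fund) ?wD// /abs_root /g; case: ifP => wap.
    by rewrite wK ap mul1r odd_extension_pos.
  rewrite linearN/= wK negE// ap/= (odd_extensionN D_root Psi_fund)//.
  by rewrite odd_extension_pos.
transitivity (\prod_(a <- pos) G a).
  apply: (big_abs_root D_root Psi_fund) => //.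
  - exact: can_inj wK.
  - by move=> a; rewrite linearN.
rewrite /G big_split/=; congr (_ * _); apply: eq_bigr => a _; congr periodic_bernoulli.
rewrite int_linear_twisted_proj /p /odd_extension; case: ifP => _ //.
by rewrite opprD.
Qed.

End AutomorphismSymmetry.

(** * Symmetry of F *)

Section SignedAction.
Variables (R : realType) (V : vectType R) (dot : {dot V for idfun}).
Variables (D : {fset V}) (r : nat) (Psi : r.-tuple V) (lam : 'I_r -> V).
Hypotheses (D_root : root_system dot D) (D_reduced : reduced D).
Hypotheses (D_irreducible : irreducible dot D) (D_notA1 : ~ type_A1 D).
Hypotheses (Psi_fund : fundamental_system D Psi).
Hypotheses (lam_weights : fundamental_weights dot Psi lam).
Variables (w : 'End(V)) (w_Aut : Aut D w).
Local Notation C := R[i].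
Local Notation pos := (pos_roots D Psi).
Local Notation abs := (abs_root D Psi).
Local Notation w' := (w^-1)%VF.

Let posD a : a \in pos -> a \in D. Proof. exact: pos_root. Qed.

Lemma abs_root_fset (f : 'End(V)) (f_Aut : Aut D f) (a : pos) : abs (f (val a)) \in pos.
Proof.
by apply: (abs_root_pos D_root Psi_fund); apply: Aut_root f_Aut _ _;
  exact: posD (valP a).
Qed.

Definition pos_action (f : 'End(V)) (f_Aut : Aut D f) (a : pos) : pos :=
  [` abs_root_fset f_Aut a].

Lemma pos_actionK (f g : 'End(V)) (f_Aut : Aut D f) (g_Aut : Aut D g) : cancel f g ->
  cancel (pos_action f_Aut) (pos_action g_Aut).
Proof.
move=> fK a; apply: val_inj => /=; have ap := valP a; have aD := posD ap.
rewrite {2}/abs_root; case: ifP => _; first by rewrite fK /abs_root ap.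
by rewrite linearN/= fK /abs_root (neg_root D_root Psi_fund aD) ap opprK.
Qed.

Let tau := pos_action w_Aut.
Let tau' := pos_action (Aut_inv w_Aut).
Let tauK : cancel tau tau'. Proof. by apply: pos_actionK; exact: Aut_invK w_Aut. Qed.
Let tau'K : cancel tau' tau.
Proof. by apply: pos_actionK; exact: Aut_inv_linK w_Aut. Qed.

Let eps (a : pos) : C := if w (val a) \in pos then 1 else -1.

Let eps1 a : nrm (eps a) = 1.
Proof. by rewrite /eps; case: ifP => _; rewrite ?nrmN -[1]/(1%:C) nrmC normr1. Qed.

Lemma act_tE (t : root_vector D Psi C) : act_t w' t = signed_perm tau eps t.
Proof.
apply/ffunP => a; rewrite !ffunE (Aut_invV w_Aut).
have ap := valP a; have aD := posD ap; have waD := Aut_root w_Aut aD.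
have -> : t (tau a) = at_root t (w (val a)).
  by rewrite -(at_root_abs D_root Psi_fund)// (at_root_pos _ (abs_root_fset w_Aut a)).
have -> : (val a \in inversion_set D Psi w) = (w (val a) \notin pos).
  have := in_inversion_set D_root Psi_fund (Aut_inv w_Aut) (val a).
  by rewrite (Aut_invV w_Aut) ap.
by rewrite /eps; case: (_ \in pos); rewrite /= ?mul1r ?mulN1r.
Qed.

Lemma act_kE (k : root_vector D Psi nat) : act_k w' k = [ffun a => k (tau a)].
Proof.
apply/ffunP => a; rewrite !ffunE (Aut_invV w_Aut).
rewrite -(at_root_abs D_root Psi_fund) ?(at_root_pos _ (abs_root_fset w_Aut a))//.
by apply: Aut_root w_Aut _ _; exact: posD (valP a).
Qed.

Lemma inversion_sign_eps (k : root_vector D Psi nat) :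
  (inversion_sign w k)%:C = \prod_a eps a ^+ k (tau a).
Proof.
rewrite /inversion_sign big_seq_fsetE/= rmorph_prod [LHS](reindex_inj (can_inj tauK)).
apply: eq_bigr => a _; rewrite at_root_val /eps.
have ap := valP a; have aD := posD ap.
(* [tau a] is w a up to sign, so w^-1 returns it to a with that same sign. *)
have -> : (w' (val (tau a)) \in pos) = (w (val a) \in pos).
  rewrite /tau /pos_action /= /abs_root; case: ifP => _.
    by rewrite (Aut_invK w_Aut) ap.
  by rewrite linearN/= (Aut_invK w_Aut) (neg_root D_root Psi_fund aD) ap.
by case: ifP => _; rewrite ?expr1n ?rmorph1// rmorphXn rmorphN rmorph1.
Qed.

(** The sign of [P] and the sign of the monomial in t are the same, so they cancel. *)
Lemma F_term_symmetry (t : root_vector D Psi C) y (k : root_vector D Psi nat) :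
  F_term dot lam (act_t w' t) (w' y) (act_k w' k) = F_term dot lam t y k.
Proof.
rewrite /F_term P_symmetry// rmorphM/= inversion_sign_eps mulrAC [RHS]mulrC;
  congr (_ * _).
rewrite -big_split/= [RHS](reindex_inj (can_inj tauK))/=; apply: eq_bigr => a _.
rewrite act_kE act_tE !ffunE exprMn mulrA.
congr (_ / _); rewrite mulrA -exprMn (_ : eps a * eps a = 1) ?expr1n ?mul1r//.
by rewrite /eps; case: ifP; rewrite ?mulr1// mulrNN mulr1.
Qed.

(** Permuting multi-indices matches the two series term by term, and unconditional sums are
    unique. *)
Lemma is_F_invariant_near0 (F : root_vector D Psi C -> V -> C) : is_F dot lam F ->
  forall y t, in_polydisc [ffun=> 0] (2 * pi) t -> act_F w F t y = F t y.
Proof.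
move=> FF y t tpi; have tlt (a : pos) : `|t a| < (2 * pi)%:C.
  by have := tpi a; rewrite ffunE subr0.
have twlt (a : pos) : `|act_t w' t a| < (2 * pi)%:C.
  by rewrite act_tE ffunE normrM normE eps1 mul1r.
apply: (multi_sum_to_unique _ ((FF y).2 t tlt)).
have := (FF (w' y)).2 _ twlt.
pose phi (k : root_vector D Psi nat) : root_vector D Psi nat := [ffun a => k (tau a)].
pose psi (k : root_vector D Psi nat) : root_vector D Psi nat := [ffun a => k (tau' a)].
have phiK : cancel phi psi by move=> k; apply/ffunP => a; rewrite !ffunE tau'K.
have psiK : cancel psi phi by move=> k; apply/ffunP => a; rewrite !ffunE tauK.
move=> /(multi_sum_to_reindex phiK psiK); congr multi_sum_to.
by apply/funext => k /=; rewrite /phi -act_kE F_term_symmetry.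
Qed.

Lemma meromorphic_eq_act_F (F : root_vector D Psi C -> V -> C) : is_F dot lam F ->
  forall y, meromorphic_eq (fun t => act_F w F t y) (fun t => F t y).
Proof.
move=> FF y.
have mw : meromorphic (fun t => act_F w F t y).
  rewrite (_ : (fun t => _) = (F^~ (w' y)) \o signed_perm tau eps).
    exact: (meromorphic_signed_perm tauK tau'K eps1 (FF (w' y)).1).
  by apply/funext => t; rewrite /act_F act_tE.
split=> //; first exact: (FF y).1.
apply: (meromorphic_identity (d := 2 * pi)) => //; first by rewrite mulr_gt0// pi_gt0.
- exact: (FF y).1.
- by move=> t; exact: is_F_invariant_near0.
Qed.
End SignedAction.

Theorem theorem5p5 (R : realType) (V : vectType R) (dot : {dot V for idfun})
    (D : {fset V}) (r : nat) (Psi : r.-tuple V) (lam : 'I_r -> V)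
    (D_root : root_system dot D) (D_reduced : reduced D)
    (D_irreducible : irreducible dot D) (D_notA1 : ~ type_A1 D)
    (Psi_fundamental : fundamental_system D Psi)
    (lam_weights : fundamental_weights dot Psi lam)
    (w : 'End(V)) (w_Aut : Aut D w) :
  (forall F : root_vector D Psi R[i] -> V -> R[i], is_F dot lam F ->
     forall y : V, meromorphic_eq (fun t => act_F w F t y) (fun t => F t y)) /\
  (forall (k : root_vector D Psi nat) (y : V),
     act_P w (P dot lam) k y =
     (\prod_(a <- inversion_set D Psi (w^-1)%VF) (-1) ^- at_root k a)
       * P dot lam k y).
Proof.
split; first by move=> F FF y; exact: (meromorphic_eq_act_F D_root).
by move=> k y;
  rewrite /act_P (P_symmetry D_root)// (inversion_signE D_root Psi_fundamental w_Aut).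
Qed.
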